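(* Suppose the finite-range defining potential $\Phi$ is translation-invariant and the disorder distribution $\mathbb P$ is asymptotically decoupled. Let $K^{\bar\sigma}$ be a translation-invariant joint measure constructed with spin boundary condition $\bar\sigma$, let $K$ be a translation-invariant probability measure on the joint configuration space, and let $K_d$ be its marginal on the disorder variables $\eta$. Then $$h(K|K^{\bar\sigma})=h(K_d|\mathbb P)-h(K)+h(K_d)+\sum_{A\ni0}\frac1{|A|}K\big(\Phi_A\big)+K\Big(\lim_{n\to\infty}\frac1{|\Lambda_n|}\log Z^{\bar\sigma}_{\Lambda_n}[\eta]\Big),$$ where the limit inside the last expectation exists for $K$-a.e. configuration.
   Context: Let $E,E'$ be finite sets; spin configurations $\sigma\in E^{\mathbb Z^d}$, disorder configurations $\eta\in(E')^{\mathbb Z^d}$, joint configurations $\xi=(\sigma,\eta)$. A defining potential $\Phi=(\Phi_A)_{A\text{ finite}}$ consists of real functions with $\Phi_A(\sigma,\eta)$ depending only on $(\sigma_A,\eta_A)$; finite range $r$: $\Phi_A=0$ if $\operatorname{diam}A>r$; translation-invariant: $\Phi_{A+x}(\xi)=\Phi_A(\tau_x\xi)$ with $(\tau_x\xi)(y)=\xi(x+y)$. Quenched finite-volume Gibbs measures: $\mu^{\bar\sigma}_\Lambda[\eta](B)=Z^{\bar\sigma}_\Lambda[\eta]^{-1}\sum_{\sigma_\Lambda}1_B(\sigma_\Lambda\bar\sigma_{\mathbb Z^d\setminus\Lambda})\exp(-\sum_{A\cap\Lambda\neq\emptyset}\Phi_A(\sigma_\Lambda\bar\sigma_{\mathbb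 Z^d\setminus\Lambda},\eta))$, with partition function $Z^{\bar\sigma}_\Lambda[\eta]$. A joint measure $K^{\bar\sigma}$ is a weak limit of $\mathbb P(d\eta)\mu^{\bar\sigma}_{\Lambda_N}[\eta](d\sigma)$ along some $\Lambda_N\uparrow\mathbb Z^d$, $\mathbb P$ a probability measure on $(E')^{\mathbb Z^d}$. $\Lambda_n=[-n,n]^d\cap\mathbb Z^d$. $\mathbb P$ is asymptotically decoupled if it is translation-invariant and there are $g_n,c_n$ with $c_n/|\Lambda_n|\to0$, $g_n/n\to0$, and $e^{-c_n}\le\mathbb P(A\cap B)/(\mathbb P(A)\mathbb P(B))\le e^{c_n}$ for all $A$ measurable w.r.t. coordinates in $\Lambda_n$, $B$ measurable w.r.t. coordinates outside $\Lambda_{n+g_n}$, with $\mathbb P(A)\mathbb P(B)\neq0$. For translation-invariant measures: $h(Q|Q')=\lim_n|\Lambda_n|^{-1}\sum_{\zeta_{\Lambda_n}}Q(\zeta_{\Lambda_n})\log\frac{Q(\zeta_{\Lambda_n})}{Q'(\zeta_{\Lambda_n})}$ (relative entropy density) and $h(Q)=-\lim_n|\Lambda_n|^{-1}\sum_{\zeta_{\Lambda_n}}Q(\zeta_{\Lambda_n})\log Q(\zeta_{\Lambda_n})$ (Kolmogorov–Sinai entropy). $K(f)$ denotes $\int f\,dK$. *)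

(* Defs.v *)
From HB Require Import structures.
From mathcomp Require Import all_boot all_order all_algebra finmap.
From mathcomp Require Import all_classical all_reals all_analysis.

Set Implicit Arguments.
Unset Strict Implicit.
Unset Printing Implicit Defensive.

Import Order.TTheory GRing.Theory Num.Theory numFieldNormedType.Exports.
Local Open Scope classical_set_scope.
Local Open Scope ring_scope.

(* Finite, nonempty single-site spaces (E, E'); "pointed" is needed for the
   measurable-space structure of MathComp-Analysis. *)
HB.structure Definition FinPointed := {T of Finite T & Pointed T}.
HB.saturate prod.

Definition site (d : nat) := 'rV[int]_d.
Definition cfg (d : nat) (T : Type) := site d -> T.

Section Defs.
Variables (R : realType) (d : nat).

Definition shift (T : Type) (x : site d) (w : cfg d T) : cfg d T :=
  fun y => w (x + y).

Definition coordsets (T : Type) (S : set (site d)) : set (set (cfg d T)) :=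
  [set C | exists x a, S x /\ C = [set w | w x = a]].

Definition cfgm (T : FinPointed.type) :=
  g_sigma_algebraType (@coordsets T setT).

Definition box (n : nat) : {fset site d} :=
  fset_set [set x : site d | forall i : 'I_d,
     (- (n%:Z) <= x ord0 i)%R /\ (x ord0 i <= n%:Z)%R].

Definition boxcard (n : nat) : nat := #|` box n|.

Definition cyl (T : Type) (L : {fset site d}) (z : {ffun L -> T}) : set (cfg d T) :=
  [set w | forall x : L, w (val x) = z x].

Definition cylp (T : Type) (mu : set (cfg d T) -> \bar R) (L : {fset site d})
  (z : {ffun L -> T}) : R := fine (mu (cyl z)).

Definition relterm (q q' : R) : \bar R :=
  if q == 0 then 0%E else if q' == 0 then +oo%E else (q * ln (q / q'))%:E.

Definition entterm (q : R) : \bar R :=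
  if q == 0 then 0%E else (- (q * ln q))%:E.

Definition relent_seq (T : finType) (mu nu : set (cfg d T) -> \bar R) (n : nat)
  : \bar R :=
  (((boxcard n)%:R)^-1)%:E *
    (\sum_(z : {ffun box n -> T}) relterm (cylp mu z) (cylp nu z))%E.

Definition ent_seq (T : finType) (mu : set (cfg d T) -> \bar R) (n : nat)
  : \bar R :=
  (((boxcard n)%:R)^-1)%:E *
    (\sum_(z : {ffun box n -> T}) entterm (cylp mu z))%E.

Definition marg2 (E E' : Type) (mu : set (cfg d (E * E')) -> \bar R)
  : set (cfg d E') -> \bar R :=
  fun B => mu ((fun w x => (w x).2) @^-1` B).

Definition pairc (E E' : Type) (s : cfg d E) (e : cfg d E') : cfg d (E * E') :=
  fun x => (s x, e x).

Definition glue (E : Type) (L : {fset site d}) (s : {ffun L -> E}) (sb : cfg d E)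
  : cfg d E :=
  fun x => match insub x with Some y => s y | None => sb x end.

Definition fshift (A : {fset site d}) (x : site d) : {fset site d} :=
  [fset (a + x)%R | a in A]%fset.

Definition diam (A : {fset site d}) : nat :=
  \max_(x <- enum_fset A) \max_(y <- enum_fset A) \max_(i < d)
     `|x ord0 i - y ord0 i|%N.

Section Potential.
Variables (E E' : FinPointed.type).
Variable Phi : {fset site d} -> cfg d (E * E') -> R.

Definition pot_local : Prop :=
  forall A w w', (forall x, x \in A -> w x = w' x) -> Phi A w = Phi A w'.

Definition pot_finite_range : Prop :=
  exists r : nat, forall A, (r < diam A)%N -> forall w, Phi A w = 0.

Definition pot_trans_inv : Prop :=
  forall A x w, Phi (fshift A x) w = Phi A (shift x w).

(* sum_{A cap Lambda <> empty} Phi_A(xi) (finitely many nonzero terms) *)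
Definition hamiltonian (L : {fset site d}) (w : cfg d (E * E')) : R :=
  \sum_(A \in [set A : {fset site d} | (A `&` L)%fset != fset0]) Phi A w.

Variable (L : {fset site d}) (sb : cfg d E).

Definition Zpart (eta : cfg d E') : R :=
  \sum_(s : {ffun L -> E}) expR (- hamiltonian L (pairc (glue s sb) eta)).

End Potential.

(* continuity for the product topology of discrete finite spaces *)
Definition quasilocal (T : Type) (f : cfg d T -> R) : Prop :=
  forall w (e : R), 0 < e -> exists L : {fset site d},
    forall w', (forall x, x \in L -> w' x = w x) -> `|f w' - f w| < e.

Definition trans_inv_meas (T : FinPointed.type) (mu : set (cfgm T) -> \bar R)
  : Prop :=
  forall (x : site d) (B : set (cfgm T)), measurable B ->
    mu (shift x @^-1` B) = mu B.

Definition asympt_decoupled (E' : FinPointed.type)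
  (P : probability (cfgm E') R) : Prop :=
  trans_inv_meas P /\
  exists (g : nat -> nat) (c : nat -> R),
    ((fun n => c n / (boxcard n)%:R) @ \oo --> (0 : R)) /\
    ((fun n => (g n)%:R / n%:R) @ \oo --> (0 : R)) /\
    forall (n : nat) (A B : set (cfg d E')),
      <<s @coordsets E' [set x | x \in box n] >> A ->
      <<s @coordsets E' [set x | x \notin box (n + g n)] >> B ->
      fine (P A) * fine (P B) != 0 ->
      expR (- c n) <= fine (P (A `&` B)) / (fine (P A) * fine (P B))
        <= expR (c n).

Section Joint.
Variables (E E' : FinPointed.type).
Variables (Phi : {fset site d} -> cfg d (E * E') -> R)
  (P : probability (cfgm E') R) (sb : cfg d E).

(* integral of f against P(d eta) mu^{sb}_L[eta](d sigma) *)
Definition Qint (L : {fset site d}) (f : cfg d (E * E') -> R) : \bar R :=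
  (\int[P]_eta
     (\sum_(s : {ffun L -> E})
        (expR (- hamiltonian Phi L (pairc (glue s sb) eta))
           / Zpart Phi L sb eta) * f (pairc (glue s sb) eta))%:E)%E.

(* Kb is a joint measure with boundary condition sb: a weak limit of
   P(d eta) mu^{sb}_{Lambda_N}[eta](d sigma) along some Lambda_N increasing
   to Z^d *)
Definition is_joint_measure (Kb : probability (cfgm (E * E')%type) R) : Prop :=
  exists Ls : nat -> {fset site d},
    (forall N, (Ls N `<=` Ls N.+1)%fset) /\
    (forall x : site d, exists N, x \in Ls N) /\
    forall f : cfg d (E * E') -> R, quasilocal f ->
      Qint (Ls N) f @[N --> \oo] --> (\int[Kb]_w (f w)%:E)%E.

End Joint.
End Defs.

(* Main.v *)
(* The cylinder probabilities of a joint measure factorise up to a surface term: resampling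
   the spins inside a box S changes the finite-volume Gibbs weight of a larger volume by the
   free-boundary energy of S up to e^{O(|bd S|)}, so Kb(sigma_S, eta_S) equals
   P(eta_S) exp(- H_S(sigma_S, eta_S)) / Z_S(eta_S) up to that factor. Taking logarithms and
   integrating against K splits the relative entropy into the announced terms, and it remains
   to prove that each of them has a density.
   - The entropies are subadditive along tilings, and the relative entropy with respect to an
     asymptotically decoupled measure is almost superadditive along separated tilings; both
     densities exist by Fekete's argument.
   - The energy is a sum of translates of a local function, up to a surface term.
   - log Z_S is additive up to surface terms, hence log Z / volume is uniformly close to the
     ergodic averages of its value on a smaller box. These converge almost everywhere by the
     ergodic theorem for Z^d actions, obtained from the Vitali maximal inequality: a
     parallelogram argument makes the averages A_n f Cauchy in L^2, and along a sparse
     subsequence the maximal functions of the differences are summable; since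
     A_n (A_k f) - A_k f is uniformly small for k large, A_n f is then almost everywhere
     Cauchy. *)
Require Import Defs.
From HB Require Import structures.
From mathcomp Require Import all_boot all_order all_algebra finmap.
From mathcomp Require Import all_classical all_reals all_analysis.
From mathcomp Require Import measurable_realfun.
From mathcomp Require Import zify ring lra.
Import Order.TTheory GRing.Theory Num.Theory numFieldNormedType.Exports.
Local Open Scope classical_set_scope.
Local Open Scope ring_scope.

Set Implicit Arguments.
Unset Strict Implicit.
Unset Printing Implicit Defensive.

(** Relative entropies may be infinite, so nothing can be subtracted before absolute continuity is
    settled. The two-sided bounds on [Kb] make a cylinder [Kb]-null exactly when its disorder part
    is [P]-null. Hence, for cylinders charged by [K], both relative entropies become infinite on the
    same boxes, and the identity can be stated at finite volume as an extended real plus a real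
    number. All surface errors have one shape, a constant times the number of sites of [bd r S]. The
    boundary condition disappears by the same mechanism: [Zpart] is replaced by the free partition
    function [Zf], which reads the disorder only inside its volume and is therefore covariant under
    translations and almost additive. The almost sure limit of the pressure is never identified:
    existence and expectation are all that is asked, so Cauchy estimates suffice and no invariant
    sigma-algebra enters. Dominated convergence moves the limit through the integral. The gap of the
    decoupling condition is absorbed by tiles of radius [m] placed with period [2 (m + g m) + 1];
    the corridors between them take a vanishing share of the volume. *)

Local Notation shift := Defs.shift.
Local Notation glue := Defs.glue.

(** * Boxes and tilings of the lattice *)

Section Boxes.
Variable d : nat.
Implicit Types (x y : site d) (A B : {fset site d}) (n m k : nat).

Lemma siteP x y : (forall i, x ord0 i = y ord0 i) -> x = y.
Proof. by move=> xy; apply/rowP => i; exact: xy. Qed.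

Lemma siteD x y i : (x + y) ord0 i = (x ord0 i + y ord0 i)%R :> int.
Proof. by rewrite mxE. Qed.

Lemma siteB x y i : (x - y) ord0 i = (x ord0 i - y ord0 i)%R :> int.
Proof. by rewrite !mxE. Qed.

Lemma siteMn x k i : (x *+ k) ord0 i = (x ord0 i * k%:Z)%R :> int.
Proof. by rewrite mulmxnE pmulrn mulrzz. Qed.

Lemma in_fshift A x y : (y \in fshift A x) = (y - x \in A).
Proof.
apply/imfsetP/idP => [[a /= aA ->]|yA]; first by rewrite addrK.
by exists (y - x); rewrite ?subrK.
Qed.

Lemma card_fshift A x : #|` fshift A x| = #|` A|.
Proof. by rewrite card_imfset //; apply: addIr. Qed.

Lemma sum_fshift (V : nmodType) (G : site d -> V) A x :
  \sum_(y <- fshift A x) G y = \sum_(a <- A) G (a + x).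
Proof. by rewrite big_imfset //= => a b _ _; apply: addIr. Qed.

Definition boxset n : set (site d) :=
  [set x | forall i, (- (n%:Z) <= x ord0 i)%R /\ (x ord0 i <= n%:Z)%R].

Definition box_of n (f : {ffun 'I_d -> 'I_(n.*2.+1)}) : site d :=
  \row_i ((f i)%:Z - n%:Z).

Lemma box_of_inj n : injective (@box_of n).
Proof.
move=> f g /rowP fg; apply/ffunP => i; apply/val_inj => /=.
by have := fg i; rewrite !mxE; lia.
Qed.

Lemma boxset_image n : boxset n = @box_of n @` setT.
Proof.
apply/seteqP; split=> [x xn|_ [f _ <-] i].
  exists [ffun i => inord (absz (x ord0 i + n%:Z))] => //.
  apply/siteP => i; have [x1 x2] := xn i; rewrite !mxE ffunE.
  by rewrite inordK; lia.
by rewrite !mxE; have := ltn_ord (f i); lia.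
Qed.

Lemma finite_boxset n : finite_set (boxset n).
Proof. by rewrite boxset_image; apply: finite_image; exact: finite_finset. Qed.

Lemma in_box n x : (x \in box d n) = [forall i, (`|x ord0 i| <= n)%N].
Proof.
rewrite in_fset_set; last exact: finite_boxset.
apply/idP/forallP => [/set_mem xn i|xn]; first by have [x1 x2] := xn i; lia.
by apply/mem_set => i; have := xn i; lia.
Qed.

Lemma boxP n x : reflect (forall i, (`|x ord0 i| <= n)%N) (x \in box d n).
Proof. by rewrite in_box; apply: forallP. Qed.

Lemma card_box n : boxcard d n = (n.*2.+1 ^ d)%N.
Proof.
rewrite /boxcard.
have -> : box d n = [fset box_of f | f : {ffun 'I_d -> 'I_(n.*2.+1)}]%fset.
  apply/fsetP => x; rewrite in_fset_set; last exact: finite_boxset.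
  rewrite -/(boxset n) boxset_image; apply/idP/imfsetP.
    by move=> /set_mem[f _ <-]; exists f.
  by move=> [f /= _ ->]; apply/mem_set; exists f.
rewrite card_imfset //=; last exact: box_of_inj.
by rewrite -cardE card_ffun !card_ord.
Qed.

Lemma box_gt0 n : (0 < boxcard d n)%N.
Proof. by rewrite card_box expn_gt0. Qed.

Lemma box0 n : 0 \in box d n.
Proof. by apply/boxP => i; rewrite mxE. Qed.

Lemma sub_box n m : (n <= m)%N -> (box d n `<=` box d m)%fset.
Proof.
move=> nm; apply/fsubsetP => x /boxP xn; apply/boxP => i.
exact: leq_trans (xn i) nm.
Qed.

Lemma boxD n m x y : x \in box d n -> y \in box d m -> x + y \in box d (n + m).
Proof.
move=> /boxP xn /boxP ym; apply/boxP => i.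
by rewrite siteD; have := xn i; have := ym i; lia.
Qed.

Lemma boxN n x : (- x \in box d n) = (x \in box d n).
Proof. by rewrite !in_box; apply: eq_forallb => i; rewrite mxE abszN. Qed.

Lemma fshift_box_sub n m x :
  x \in box d m -> (fshift (box d n) x `<=` box d (n + m))%fset.
Proof.
move=> xm; apply/fsubsetP => y; rewrite in_fshift => yx.
by rewrite -(subrK x y) boxD.
Qed.

Lemma leq_boxcard n m : (n <= m)%N -> (boxcard d n <= boxcard d m)%N.
Proof. by move=> /sub_box /fsubset_leq_card. Qed.

(** In each coordinate [4 n + 1 <= 2 (2 n + 1)]. This doubling is the source of the constant [2 ^ d]
    in the covering and maximal inequalities. *)
Lemma boxcard_double n : (boxcard d n.*2 <= 2 ^ d * boxcard d n)%N.
Proof.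
rewrite !card_box -expnMn; have [->//|d0] := posnP d.
by rewrite leq_exp2r //; lia.
Qed.

(** Two radii serve two purposes: with [m = M] the tiles pave the lattice, as subadditivity wants,
    and with [m < M] neighbouring tiles are separated by corridors, as decoupling wants. *)
Definition tile m M (u : site d) : {fset site d} := fshift (box d m) (u *+ M.*2.+1).

Definition tiles m M (U : seq (site d)) : {fset site d} :=
  (\bigcup_(u <- U) tile m M u)%fset.

Lemma tiles_cons m M u U : tiles m M (u :: U) = (tile m M u `|` tiles m M U)%fset.
Proof. by rewrite /tiles big_cons. Qed.

Lemma tilesP m M U x :
  reflect (exists2 u, u \in U & x - u *+ M.*2.+1 \in box d m) (x \in tiles m M U).
Proof.
elim: U => [|u U IH].
  by rewrite /tiles big_nil; apply: (iffP idP) => // -[].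
rewrite tiles_cons inE in_fshift; apply: (iffP orP).
  case=> [xu|/IH[v vU xv]]; first by exists u; rewrite // mem_head.
  by exists v => //; rewrite in_cons vU orbT.
case=> v; rewrite in_cons => /orP[/eqP ->|vU] xv; first by left.
by right; apply/IH; exists v.
Qed.

(* Distinct tile centres are at distance at least [2M + 1], so the other tiles stay
   outside the box of radius [M] around the centre. *)
Lemma tiles_far m M u U x : (m <= M)%N -> u \notin U -> x \in tiles m M U ->
  x - u *+ M.*2.+1 \notin box d M.
Proof.
move=> mM uU /tilesP[v vU xv]; apply/negP => xu.
suff uv : u = v by rewrite uv vU in uU.
apply/siteP => i; move/boxP/(_ i) : xv; move/boxP/(_ i) : xu.
rewrite !siteB !siteMn; nia.
Qed.

Lemma tiles_box_sub m M k : (m <= M)%N ->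
  (tiles m M (box d k) `<=` box d (M + M.*2.+1 * k))%fset.
Proof.
move=> mM; apply/fsubsetP => x /tilesP[u /boxP uk /boxP xu]; apply/boxP => i.
have := uk i; have := xu i; rewrite !siteB !siteMn; nia.
Qed.

End Boxes.

(** * Sums over tilings and growth of box volumes *)

Section BoxSums.
Variable d : nat.
Implicit Types (x y : site d) (A B : {fset site d}) (n m k : nat).

Lemma sum_fsetU (V : nmodType) (I : choiceType) (A B : {fset I}) (G : I -> V) :
  [disjoint A & B]%fset ->
  \sum_(x <- (A `|` B)%fset) G x = \sum_(x <- A) G x + \sum_(x <- B) G x.
Proof.
move=> AB; rewrite (big_fsetID _ (mem A)) /=; congr (_ + _); apply: eq_fbig => //= x.
  by rewrite !inE /=; case: (x \in A) => //; rewrite andbF.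
rewrite !inE /=; have [xA|] := boolP (x \in A); last by rewrite andbT.
by rewrite andbF; move/fdisjointP/(_ x xA)/negbTE : AB => ->.
Qed.

Lemma tiles_disjoint m M u (U : seq (site d)) : (m <= M)%N -> u \notin U ->
  [disjoint tile m M u & tiles m M U]%fset.
Proof.
move=> mM uU; apply/fdisjointP => x; rewrite in_fshift => xu.
apply: contraL xu => /(tiles_far mM uU).
by apply: contraNN => /(fsubsetP (sub_box d mM)).
Qed.

Lemma sum_tiles (V : nmodType) (G : site d -> V) m M (U : seq (site d)) :
  (m <= M)%N -> uniq U ->
  \sum_(z <- tiles m M U) G z = \sum_(u <- U) \sum_(y <- box d m) G (y + u *+ M.*2.+1).
Proof.
move=> mM; elim: U => [_|u U IH /= /andP[uU Uu]].
  by rewrite /tiles big_nil big_seq_fset0 big_nil.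
rewrite tiles_cons sum_fsetU; last exact: tiles_disjoint.
by rewrite big_cons IH // sum_fshift.
Qed.

Lemma boxcard_mul m k : boxcard d (m + m.*2.+1 * k) = (boxcard d k * boxcard d m)%N.
Proof. rewrite !card_box -expnMn; congr (_ ^ _)%N; nia. Qed.

Lemma card_tiles m M (U : seq (site d)) : (m <= M)%N -> uniq U ->
  #|` tiles m M U| = (size U * boxcard d m)%N.
Proof.
move=> mM Uu; rewrite card_fset_sum1.
rewrite (@sum_tiles nat (fun=> 1%N)) //.
under eq_bigr do rewrite -card_fset_sum1.
by rewrite big_const_seq count_predT iter_addn_0 mulnC.
Qed.

(** Inclusion and counting: [2 (m + (2 m + 1) k) + 1 = (2 m + 1) (2 k + 1)]. *)
Lemma tiles_box m k : tiles m m (box d k) = box d (m + m.*2.+1 * k).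
Proof.
apply/eqP; rewrite eqEfcard; apply/andP; split; first exact: tiles_box_sub.
have e := boxcard_mul m k; rewrite card_tiles ?fset_uniq //.
by rewrite /boxcard in e *; rewrite e.
Qed.

Lemma sum_box_tiles (V : nmodType) (G : site d -> V) m k :
  \sum_(z <- box d (m + m.*2.+1 * k)) G z
    = \sum_(u <- box d k) \sum_(y <- box d m) G (y + u *+ m.*2.+1).
Proof. by rewrite -tiles_box sum_tiles ?fset_uniq. Qed.

Section Growth.
Variable R : realType.
Local Notation vol n := ((boxcard d n)%:R : R).

Lemma vol_gt0 n : 0 < vol n.
Proof. by rewrite ltr0n box_gt0. Qed.

Lemma vol_neq0 n : vol n != 0.
Proof. by rewrite gt_eqF // vol_gt0. Qed.

Lemma vol_le n m : (n <= m)%N -> vol n <= vol m.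
Proof. by move=> nm; rewrite ler_nat leq_boxcard. Qed.

(** The ratio of side lengths is at most [1 + j n / n], whose [d]-th power tends to 1. The width [j]
    may grow with [n] so that the gap of the decoupling condition is covered. *)
Lemma box_grow (j : nat -> nat) (e : R) : 0 < e ->
  (fun n => (j n)%:R / n%:R : R) @ \oo --> (0 : R) ->
  \forall n \near \oo, vol (n + j n) <= (1 + e) * vol n.
Proof.
move=> e0 jn.
have : (fun n => (1 + (j n)%:R / n%:R : R) ^+ d) @ \oo --> ((1 + 0 : R) ^+ d).
  apply: (@continuous_cvg _ _ _ _ _ _ (fun x : R => x ^+ d)); first exact: exprn_continuous.
  by apply: cvgD => //; exact: cvg_cst.
rewrite addr0 expr1n => /cvgr_le /(_ (1 + e)).
rewrite ltrDl e0 => /(_ isT); apply: filter_app.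
near=> n => h.
have n0 : (0 < n)%N by near: n; exact: nbhs_infty_gt.
apply: le_trans (ler_wpM2r _ h) => //.
rewrite !card_box !natrX -exprMn; apply: lerXn2r; rewrite ?nnegrE ?ler0n //.
have n0' : (0 : R) < n%:R by rewrite ltr0n.
rewrite -(ler_pM2r n0') mulrAC mulrDl mul1r divfK ?gt_eqF //.
rewrite -natrD -!natrM ler_nat; nia.
Unshelve. all: by end_near. Qed.

Lemma box_growC (j : nat) (e : R) : 0 < e ->
  \forall n \near \oo, vol (n + j) <= (1 + e) * vol n.
Proof.
move=> e0; apply: (box_grow (j := fun=> j)) => //.
rewrite -[X in _ --> X](mulr0 (j%:R : R)).
apply: cvgM; first exact: cvg_cst.
apply/gtr0_cvgV0; first by near=> n; rewrite ltr0n; near: n; exact: nbhs_infty_gt.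
exact: cvgr_idn.
Unshelve. all: by end_near. Qed.

Lemma box_shrink (j : nat) (e : R) : 0 < e ->
  \forall n \near \oo, vol n <= (1 + e) * vol (n - j).
Proof.
move=> e0; have [N _ hN] := box_growC j e0.
exists (N + j)%N => // n /= Nn.
have -> : vol n = vol (n - j + j) by congr (boxcard _ _)%:R; lia.
by apply: hN => /=; lia.
Qed.

End Growth.
End BoxSums.

(** * Bounded random variables *)

Section BoundedMeasurable.
Context {disp : measure_display} {T : measurableType disp} {R : realType}.
Implicit Types f g : T -> R.

Definition bmeas f : Prop :=
  measurable_fun [set: T] f /\ exists M : R, forall w, `|f w| <= M.

Lemma bmeas_cst (a : R) : bmeas (fun=> a).
Proof. by split; [exact: measurable_cst|exists `|a|]. Qed.

Lemma bmeasD f g : bmeas f -> bmeas g -> bmeas (fun w => f w + g w).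
Proof.
move=> [mf [M fM]] [mg [N gN]]; split; first exact: measurable_funD.
by exists (M + N) => w; apply: le_trans (ler_normD _ _) _; exact: lerD.
Qed.

Lemma bmeasM f g : bmeas f -> bmeas g -> bmeas (fun w => f w * g w).
Proof.
move=> [mf [M fM]] [mg [N gN]]; split; first exact: measurable_funM.
by exists (M * N) => w; rewrite normrM ler_pM.
Qed.

Lemma bmeasZ (a : R) f : bmeas f -> bmeas (fun w => a * f w).
Proof. exact: bmeasM (bmeas_cst a). Qed.

Lemma bmeasN f : bmeas f -> bmeas (fun w => - f w).
Proof.
move=> [mf [M fM]]; split; first exact: measurableT_comp.
by exists M => w; rewrite normrN.
Qed.

Lemma bmeasB f g : bmeas f -> bmeas g -> bmeas (fun w => f w - g w).
Proof. by move=> bf bg; apply: bmeasD => //; exact: bmeasN. Qed.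

Lemma bmeasX2 f : bmeas f -> bmeas (fun w => f w ^+ 2).
Proof. by move=> bf; exact: bmeasM. Qed.

Lemma bmeas_norm f : bmeas f -> bmeas (fun w => `|f w|).
Proof.
move=> [mf [M fM]]; split; first exact: measurableT_comp.
by exists M => w; rewrite normr_id.
Qed.

Lemma bmeas_sum (I : Type) (s : seq I) (P : pred I) (F : I -> T -> R) :
  (forall i, bmeas (F i)) -> bmeas (fun w => \sum_(i <- s | P i) F i w).
Proof.
move=> bF; elim: s => [|i s IH].
  by under eq_fun do rewrite big_nil; exact: bmeas_cst.
under eq_fun do rewrite big_cons.
by case: (P i) => //; exact: bmeasD.
Qed.

Lemma bmeas_comp (p : T -> T) f : measurable_fun [set: T] p -> bmeas f ->
  bmeas (fun w => f (p w)).
Proof.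
move=> mp [mf [M fM]]; split; last by exists M.
exact: (measurableT_comp mf mp).
Qed.

Lemma bmeas_indic (B : set T) : measurable B -> bmeas (fun w => \1_B w).
Proof.
move=> mB; split; first exact: measurable_indic.
by exists 1 => w; rewrite indicE; case: (w \in B); rewrite ?normr1 ?normr0.
Qed.

Variable mu : probability T R.
Local Notation Ex f := (\int[mu]_w f w).

Lemma bmeas_integrable f : bmeas f -> mu.-integrable [set: T] (EFin \o f).
Proof.
move=> [mf [M fM]]; apply: measurable_bounded_integrable => //.
  exact: (le_lt_trans (probability_le1 mu measurableT) (ltry _)).
by exists M; split; [exact: num_real|move=> x xM w _; exact: le_trans (fM w) (ltW xM)].
Qed.

Lemma ExD f g : bmeas f -> bmeas g -> Ex (fun w => f w + g w) = Ex f + Ex g.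
Proof. by move=> bf bg; rewrite RintegralD //; exact: bmeas_integrable. Qed.

Lemma ExZ (a : R) f : bmeas f -> Ex (fun w => a * f w) = a * Ex f.
Proof. by move=> bf; rewrite RintegralZl //; exact: bmeas_integrable. Qed.

Lemma ExB f g : bmeas f -> bmeas g -> Ex (fun w => f w - g w) = Ex f - Ex g.
Proof. by move=> bf bg; rewrite RintegralB //; exact: bmeas_integrable. Qed.

Lemma Ex_le f g : bmeas f -> bmeas g -> (forall w, f w <= g w) -> Ex f <= Ex g.
Proof. by move=> bf bg fg; apply: le_Rintegral => //; exact: bmeas_integrable. Qed.

Lemma Ex_cst (a : R) : Ex (fun=> a) = a.
Proof.
rewrite Rintegral_cst // -[RHS]mulr1; congr (a * _).
exact: (congr1 fine (probability_setT mu)).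
Qed.

Lemma Ex_sum (I : Type) (s : seq I) (P : pred I) (F : I -> T -> R) :
  (forall i, bmeas (F i)) ->
  Ex (fun w => \sum_(i <- s | P i) F i w) = \sum_(i <- s | P i) Ex (F i).
Proof.
move=> bF; elim: s => [|i s IH].
  by under eq_Rintegral do rewrite big_nil; rewrite Ex_cst big_nil.
under eq_Rintegral do rewrite big_cons; rewrite big_cons.
by case: (P i) => //; rewrite ExD ?IH //; exact: bmeas_sum.
Qed.

Lemma Ex_indic (B : set T) : measurable B -> Ex (fun w => \1_B w) = fine (mu B).
Proof. by move=> mB; rewrite /Rintegral integral_indic // setIT. Qed.

Lemma Ex_comp (p : T -> T) f : measurable_fun [set: T] p ->
  (forall B, measurable B -> mu (p @^-1` B) = mu B) -> bmeas f ->
  Ex (fun w => f (p w)) = Ex f.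
Proof.
move=> mp pinv bf; have [mf _] := bf.
have mEf : measurable_fun [set: T] (EFin \o f) by exact/measurable_EFinP.
rewrite /Rintegral; congr fine.
have := @integral_pushforward _ _ _ _ _ p mp mu setT (EFin \o f) mEf.
rewrite preimage_setT => <- //; last exact: bmeas_integrable (bmeas_comp mp bf).
apply: eq_measure_integral => B mB _.
exact: (pinv B mB).
Qed.

End BoundedMeasurable.

(** * A pointwise ergodic theorem for [Z^d] actions *)

Lemma cvgn_cauchy (R : realType) (u : nat -> R) :
  (forall e, 0 < e -> exists N, forall n p, (N <= n)%N -> (N <= p)%N -> `|u n - u p| <= e) ->
  cvgn u.
Proof.
move=> uC; apply/cauchy_cvgP/cauchy_exP => e e0.
have [N uN] := uC (e / 2) ltac:(by rewrite divr_gt0).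
exists (u N); exists N => // n /= Nn; rewrite -ball_normE /=.
by apply: le_lt_trans (uN _ _ _ _) _; rewrite // ltr_pdivrMr // ltr_pMr // ltr1n.
Qed.

Lemma fsubset_split (I : choiceType) (A B : {fset I}) : (A `<=` B)%fset ->
  B = (A `|` (B `\` A))%fset.
Proof.
move=> /fsubsetP AB; apply/fsetP => x; rewrite !inE.
by have [/AB->|] := boolP (x \in A).
Qed.

Lemma sum_fsub_bound (R : realType) (I : choiceType) (A B : {fset I}) (G : I -> R) M :
  (A `<=` B)%fset -> (forall i, `|G i| <= M) ->
  `|\sum_(i <- B) G i - \sum_(i <- A) G i| <= M * (#|` B|%:R - #|` A|%:R).
Proof.
move=> AB GM.
rewrite (fsubset_split AB).
have dAB : [disjoint A & B `\` A]%fset.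
  by apply/fdisjointP => x xA; rewrite inE xA.
rewrite sum_fsetU // addrAC subrr add0r.
rewrite !card_fset_sum1 sum_fsetU // natrD addrAC subrr add0r.
apply: le_trans (ler_norm_sum _ _ _) _.
by rewrite natr_sum mulr_sumr; apply: ler_sum => i _; rewrite mulr1.
Qed.

(** * A covering lemma for lattice boxes *)

Section Vitali.
Variables (R : realType) (d : nat).
Local Notation vol n := ((boxcard d n)%:R : R).

(** Greedy selection: take the site [x] of [S] with the largest radius and discard all sites of [S]
    in the box of double radius around it. The boxes of the remaining sites have no larger radius,
    so they miss the box [D] of [x], and induction applies inside [V] without [D]. The discarded
    sites are paid for by the sum over [D], at the doubling cost [2 ^ d]. *)
Lemma vitali (S V : {fset site d}) (rho : site d -> nat) (G : site d -> R) (lam : R) :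
  (forall y, 0 <= G y) -> 0 <= lam ->
  (forall x, x \in S -> (fshift (box d (rho x)) x `<=` V)%fset) ->
  (forall x, x \in S -> lam * vol (rho x) <= \sum_(y <- fshift (box d (rho x)) x) G y) ->
  lam * #|` S|%:R <= (2 ^ d)%:R * \sum_(y <- V) G y.
Proof.
move=> G0 l0; have [k] := ubnP #|` S|; elim: k S V => // k IH S V Sk SV spin_energy.
have [->|[x0 x0S]] := fset_0Vmem S.
  by rewrite cardfs0 mulr0 mulr_ge0 // sumr_ge0.
have [[x xS] _ xmax] := @arg_maxnP S [` x0S]%fset xpredT (fun z => rho (val z)) isT.
rewrite /= in xmax.
have {}xmax y : y \in S -> (rho y <= rho x)%N by move=> yS; exact: (xmax [` yS]%fset).
pose D := fshift (box d (rho x)) x.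
pose D2 := fshift (box d (rho x).*2) x.
pose S' := (S `\` D2)%fset; pose V' := (V `\` D)%fset.
have xD2 : x \in D2 by rewrite in_fshift subrr box0.
have S'k : (#|` S'| < k)%N.
  rewrite -ltnS; apply: leq_trans Sk; rewrite ltnS.
  apply: fproper_ltn_card; rewrite fproperE fsubsetDl /=.
  by apply/negP => /fsubsetP/(_ x xS); rewrite inE xD2.
have := IH S' V' S'k _ _.
have -> : \sum_(y <- V) G y = \sum_(y <- D) G y + \sum_(y <- V') G y.
  rewrite -sum_fsetU; last by apply/fdisjointP => y yD; rewrite inE yD.
  by rewrite -fsubset_split //; exact: SV.
move=> h; rewrite mulrDr.
have Scard : (#|` S| <= #|` S'| + boxcard d (rho x).*2)%N.
  rewrite /boxcard -(card_fshift (box d (rho x).*2) x) -/D2.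
  rewrite -(cardfsID D2 S) addnC leq_add2l; apply: fsubset_leq_card; exact: fsubsetIr.
have {}h : lam * #|` S'|%:R <= (2 ^ d)%:R * \sum_(y <- V') G y.
  apply: h => y; rewrite inE => /andP[yD2 yS]; last exact: spin_energy.
  apply/fsubsetP => z zy; rewrite inE (fsubsetP (SV _ yS) _ zy) andbT.
  apply: contra yD2; rewrite !in_fshift => zx.
  have -> : y - x = (z - x) + (- (z - y)) by rewrite opprB [RHS]addrC addrA subrK.
  rewrite -addnn; apply: boxD => //; rewrite boxN.
  by move: zy; rewrite in_fshift; apply: (fsubsetP (sub_box d (xmax _ yS))).
have hx : lam * vol (rho x).*2 <= (2 ^ d)%:R * \sum_(y <- D) G y.
  apply: le_trans (ler_wpM2l _ (spin_energy _ xS)); last by rewrite ler0n.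
  by rewrite mulrCA ler_wpM2l // -natrM ler_nat boxcard_double.
apply: le_trans (lerD hx h); rewrite -mulrDr ler_wpM2l // -natrD ler_nat.
by rewrite addnC.
Qed.

End Vitali.

(** * Ergodic averages, maximal inequality, almost sure convergence *)

Section Ergodic.
Context {disp : measure_display} {T : measurableType disp} {R : realType}.
Variables (d : nat) (mu : probability T R) (tau : site d -> T -> T).
Hypothesis tauD : forall x y w, tau x (tau y w) = tau (x + y) w.
Hypothesis tau_meas : forall x, measurable_fun [set: T] (tau x).
Hypothesis tau_inv : forall x B, measurable B -> mu (tau x @^-1` B) = mu B.
Implicit Types (f g : T -> R) (n m k : nat).
Local Notation vol n := ((boxcard d n)%:R : R).
Local Notation Ex f := (\int[mu]_w f w).

Definition avg n f (w : T) : R := (vol n)^-1 * \sum_(x <- box d n) f (tau x w).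

Lemma bmeas_tau x f : bmeas f -> bmeas (fun w => f (tau x w)).
Proof. exact: bmeas_comp. Qed.

Lemma bmeas_avg n f : bmeas f -> bmeas (avg n f).
Proof. by move=> bf; apply/bmeasZ/bmeas_sum => x; exact: bmeas_tau. Qed.

Lemma volV_ge0 n : 0 <= (vol n)^-1.
Proof. by rewrite invr_ge0 ler0n. Qed.

Lemma sum_box_cst n (a : R) : \sum_(x <- box d n) a = vol n * a.
Proof. by rewrite big_const_seq count_predT iter_addr_0 mulr_natl. Qed.

Lemma avg_cst n (a : R) w : avg n (fun=> a) w = a.
Proof.
by rewrite /avg sum_box_cst mulrA mulVf ?mul1r // vol_neq0.
Qed.

Lemma avgB n f g w : avg n (fun v => f v - g v) w = avg n f w - avg n g w.
Proof. by rewrite /avg -mulrBr sumrB. Qed.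

Lemma avg_le n f g w : (forall x, x \in box d n -> f (tau x w) <= g (tau x w)) ->
  avg n f w <= avg n g w.
Proof.
move=> fg; rewrite ler_wpM2l ?volV_ge0 // big_seq [leRHS]big_seq.
exact: ler_sum.
Qed.

Lemma avg_norm n f w : `|avg n f w| <= avg n (fun v => `|f v|) w.
Proof. by rewrite normrM ger0_norm ?volV_ge0 // ler_wpM2l ?volV_ge0 // ler_norm_sum. Qed.

Lemma avg_dist n f (a b : R) w :
  (forall x, x \in box d n -> `|f (tau x w) - a| <= b) -> `|avg n f w - a| <= b.
Proof.
move=> h; rewrite -[X in _ - X](avg_cst n a w) -avgB.
apply: le_trans (avg_norm _ _ _) _.
by rewrite -[leRHS](avg_cst n b w); exact: avg_le.
Qed.

Lemma Ex_tau x f : bmeas f -> Ex (fun w => f (tau x w)) = Ex f.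
Proof. exact: (@Ex_comp _ _ _ mu (tau x) f (tau_meas x) (@tau_inv x)). Qed.

Lemma Ex_avg n f : bmeas f -> Ex (avg n f) = Ex f.
Proof.
move=> bf; have bt x := bmeas_tau x bf.
rewrite ExZ ?Ex_sum //; last exact: bmeas_sum.
under eq_bigr do rewrite Ex_tau //.
have := avg_cst n (Ex f) point; rewrite /avg //.
Qed.

Lemma avg_comm n k f w : avg n (avg k f) w = avg k (avg n f) w.
Proof.
rewrite /avg -!mulr_sumr mulrCA; congr (_ * (_ * _)); rewrite exchange_big /=.
by apply: eq_bigr => x _; apply: eq_bigr => y _; rewrite !tauD addrC.
Qed.

(** Both [box d k] and its translate by [x] lie in [box d (k + n)]. Each sum is compared with the
    sum over that larger box, whence the factor 2. *)
Lemma avg_tau k n f M x w : (forall v, `|f v| <= M) -> x \in box d n ->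
  `|avg k f (tau x w) - avg k f w| <= 2 * M * ((vol (k + n) - vol k) / vol k).
Proof.
move=> fM xn; rewrite /avg -mulrBr normrM ger0_norm ?volV_ge0 //.
rewrite [leRHS]mulrA [leRHS]mulrC ler_wpM2l ?volV_ge0 //.
pose G y := f (tau y w).
have -> : \sum_(y <- box d k) f (tau y (tau x w)) = \sum_(y <- fshift (box d k) x) G y.
  by rewrite sum_fshift; apply: eq_bigr => y _; rewrite tauD.
have h1 := @sum_fsub_bound _ _ _ (box d (k + n)) G M (fshift_box_sub k xn) (fun y => fM _).
have h2 := @sum_fsub_bound _ _ _ _ G M (sub_box d (leq_addr n k)) (fun y => fM _).
rewrite card_fshift -!/(boxcard d _) in h1 h2.
move: h1 h2; rewrite !ler_norml => /andP[? ?] /andP[? ?].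
by apply/andP; split; lra.
Qed.

Lemma avg_flat n f (e : R) : bmeas f -> 0 < e ->
  \forall k \near \oo, forall w, `|avg n (avg k f) w - avg k f w| <= e.
Proof.
move=> [_ [M fM]] e0.
have M0 : 0 <= M by apply: le_trans (fM point).
(* The added 1 covers [M = 0]; the same device is used for other constants below. *)
have e'0 : 0 < e / (2 * M + 1) by rewrite divr_gt0 // ltr_wpDl // mulr_ge0.
near=> k => w; apply: avg_dist => x xn.
apply: le_trans (avg_tau _ _ fM xn) _.
have h : vol (k + n) <= (1 + e / (2 * M + 1)) * vol k by near: k; exact: box_growC.
apply: (@le_trans _ _ (2 * M * (e / (2 * M + 1)))).
  rewrite ler_wpM2l ?mulr_ge0 // ler_pdivrMr ?vol_gt0 // lerBlDr.
  by rewrite -[X in _ + X]mul1r -mulrDl addrC.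
rewrite mulrA ler_pdivrMr ?ltr_wpDl ?mulr_ge0 //.
by rewrite mulrC ler_wpM2l ?(ltW e0) // lerDl.
Unshelve. all: by end_near. Qed.

(** Superlevel set of the maximal function truncated at radius [N]. The truncation keeps every
    witnessing box within distance [N] of its centre, which makes the transfer to the lattice
    possible. *)
Definition maxbad N (lam : R) g : set T :=
  [set w | exists2 n, (n <= N)%N & lam < avg n g w].

Lemma measurable_gt g (lam : R) : bmeas g -> measurable [set w | lam < g w].
Proof.
move=> [mg _]; have := mg measurableT `]lam, +oo[%classic (measurable_itv _).
rewrite setTI; congr (measurable _); apply/seteqP.
by split=> w /=; rewrite in_itv /= andbT.
Qed.

Lemma measurable_maxbad N lam g : bmeas g -> measurable (maxbad N lam g).
Proof.
move=> bg; have -> : maxbad N lam g = \bigcup_(n in `I_N.+1) [set w | lam < avg n g w].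
  by apply/seteqP; split=> w [n nN h]; exists n.
by apply: bigcup_measurable => n _; apply: measurable_gt; exact: bmeas_avg.
Qed.

(** Transference to a single orbit: the covering lemma is applied to the sites [x] of [box d K] at
    which [tau x w] is bad, with the witnessing radius at each of them. All these boxes stay in
    [box d (K + N)]. *)
Lemma maxbad_pointwise N K lam g w : (forall v, 0 <= g v) -> 0 <= lam ->
  lam * \sum_(x <- box d K) \1_(maxbad N lam g) (tau x w)
    <= (2 ^ d)%:R * \sum_(y <- box d (K + N)) g (tau y w).
Proof.
move=> g0 l0; pose B := maxbad N lam g.
have /choice[rho rhoP] : forall x, exists n, B (tau x w) ->
    (n <= N)%N /\ lam < avg n g (tau x w).
  move=> x; have [[n nN h]|nB] := pselect (B (tau x w)); first by exists n.
  by exists 0%N.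
pose S := [fset x in box d K | tau x w \in B]%fset.
have -> : \sum_(x <- box d K) \1_B (tau x w) = #|` S|%:R :> R.
  rewrite card_fset_sum1 natr_sum -big_fset_condE /=.
  rewrite [RHS]big_mkcond /=; apply: eq_bigr => x _; rewrite indicE.
  by case: (_ \in _).
have SB x : x \in S -> x \in box d K /\ B (tau x w).
  by rewrite !inE /= => /andP[-> /set_mem].
apply: vitali => // x /SB[xK xB]; have [nN h] := rhoP x xB.
  apply: fsubset_trans (fshift_box_sub (rho x) xK) _.
  by rewrite addnC; apply: sub_box; rewrite leq_add2l.
rewrite sum_fshift -ler_pdivlMr ?vol_gt0 // mulrC; apply: ltW.
by move: h; rewrite /avg; under eq_bigr do rewrite tauD.
Qed.

(** Integrating the orbitwise bound turns, by invariance, both sums into volumes. The ratio of the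
    volumes of [box d (K + N)] and [box d K] tends to 1 as [K] grows with [N] fixed. *)
Lemma maximal_ineq N lam g : bmeas g -> (forall v, 0 <= g v) -> 0 < lam ->
  lam * fine (mu (maxbad N lam g)) <= (2 ^ d)%:R * Ex g.
Proof.
move=> bg g0 l0; set B := maxbad N lam g.
have mB : measurable B by exact: measurable_maxbad.
have Eg0 : 0 <= Ex g by apply: Rintegral_ge0.
have step K : lam * (vol K * fine (mu B)) <= (2 ^ d)%:R * (vol (K + N) * Ex g).
  have bI x := bmeas_tau x (bmeas_indic mB).
  have bt x := bmeas_tau x bg.
  have := @Ex_le _ _ _ mu (fun w => lam * \sum_(x <- box d K) \1_B (tau x w))
    (fun w => (2 ^ d)%:R * \sum_(y <- box d (K + N)) g (tau y w))
    (bmeasZ _ (bmeas_sum _ _ bI)) (bmeasZ _ (bmeas_sum _ _ bt))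
    (fun w => maxbad_pointwise N K w g0 (ltW l0)).
  rewrite !ExZ ?Ex_sum //; try exact: bmeas_sum.
  under eq_bigr do rewrite (Ex_tau _ (bmeas_indic mB)) Ex_indic //.
  under [X in _ <= _ * X -> _]eq_bigr do rewrite Ex_tau //.
  by rewrite !sum_box_cst.
apply/ler_addgt0Pr => e e0.
pose e' := e / ((2 ^ d)%:R * Ex g + 1).
have c0 : 0 <= (2 ^ d)%:R * Ex g by rewrite mulr_ge0.
have e'0 : 0 < e' by rewrite divr_gt0 // ltr_wpDl.
have [K _ hK] := @box_growC d R N e' e'0.
have {}hK := hK K (leqnn K).
have : lam * (vol K * fine (mu B)) <= (2 ^ d)%:R * ((1 + e') * vol K * Ex g).
  by apply: le_trans (step K) _; rewrite ler_wpM2l // ler_wpM2r.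
have -> : (2 ^ d)%:R * ((1 + e') * vol K * Ex g) = ((2 ^ d)%:R * Ex g * (1 + e')) * vol K.
  by rewrite !mulrA; ring.
rewrite mulrCA mulrC ler_pM2r ?vol_gt0 // => /le_trans; apply.
rewrite mulrDr mulr1 lerD2l /e' mulrA ler_pdivrMr ?ltr_wpDl //.
by rewrite mulrC ler_wpM2l ?(ltW e0) // lerDl.
Qed.

Lemma maximal_ineq_all lam c g : bmeas g -> (forall v, 0 <= g v) -> 0 < lam ->
  (2 ^ d)%:R * Ex g <= lam * c ->
  measurable (\bigcup_N maxbad N lam g) /\
  (mu (\bigcup_N maxbad N lam g) <= c%:E)%E.
Proof.
move=> bg g0 l0 hc.
have mB N := measurable_maxbad N lam bg.
have mU : measurable (\bigcup_N maxbad N lam g) by exact: bigcup_measurable.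
split=> //.
have cv := nondecreasing_cvg_mu (mu := mu) mB mU.
have {}cv := cv _; apply: (cvge_le _ (cv _)).
  apply: nearW => N /=.
  have fB : mu (maxbad N lam g) \is a fin_num by exact: fin_num_measure.
  rewrite -(fineK fB) lee_fin -(ler_pM2l l0).
  exact: le_trans (maximal_ineq N bg g0 l0) hc.
move=> N K NK; apply/subsetPset => w [n nN h]; exists n => //.
exact: leq_trans NK.
Qed.

(* A class of convex combinations of translates of [f] that is stable under [avg] and
   midpoints: an almost minimiser of the [L^2] norm in it controls [avg n f]. *)
Inductive hull f : (T -> R) -> Prop :=
| hull_id : hull f f
| hull_avg n g : hull f g -> hull f (avg n g)
| hull_mid g h : hull f g -> hull f h -> hull f (fun w => (g w + h w) / 2).

Lemma bmeas_hull f g : bmeas f -> hull f g -> bmeas g.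
Proof.
move=> bf; elim=> // [n {}g _|{}g h _ bg _ bh]; first exact: bmeas_avg.
by apply: bmeasM; [exact: bmeasD|exact: bmeas_cst].
Qed.

(** The generators of the hull are chosen for this. An average [avg k g] is handled by commutation:
    [avg n (avg k g) = avg k (avg n g)], which is close to [avg n g] by near invariance of long
    averages. *)
Lemma avg_hull f g (e : R) : bmeas f -> hull f g -> 0 < e ->
  \forall n \near \oo, forall w, `|avg n g w - avg n f w| <= e.
Proof.
move=> bf hg; elim: hg e => [|k {}g hg IH|{}g h hg IHg hh IHh] e e0.
- by apply: nearW => n w; rewrite subrr normr0 ltW.
- have e20 : 0 < e / 2 by rewrite divr_gt0.
  have := IH _ e20; have := avg_flat k (bmeas_hull bf hg) e20.
  apply: filterS2 => n h1 h2 w.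
  rewrite -(subrKA (avg n g w)); apply: le_trans (ler_normD _ _) _.
  by rewrite [leRHS]splitr lerD // avg_comm.
- have := IHg _ e0; have := IHh _ e0.
  apply: filterS2 => n h1 h2 w.
  have -> : avg n (fun v => (g v + h v) / 2) w - avg n f w
      = ((avg n g w - avg n f w) + (avg n h w - avg n f w)) / 2.
    by rewrite /avg -mulr_suml big_split /=; move: (vol n)^-1 => v; field.
  rewrite normrM [X in _ * X]ger0_norm ?invr_ge0 ?ler0n // ler_pdivrMr //.
  apply: le_trans (ler_normD _ _) _.
  by rewrite mulr_natr mulr2n lerD.
Qed.

(** Nonnegativity of the variance of [g] along the box. *)
Lemma avg_sqr n g w : avg n g w ^+ 2 <= avg n (fun v => g v ^+ 2) w.
Proof.
set a := avg n g w.
have : 0 <= avg n (fun v => (g v - a) ^+ 2) w.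
  by rewrite -[leLHS](avg_cst n 0 w); apply: avg_le => x _; exact: sqr_ge0.
have -> : avg n (fun v => (g v - a) ^+ 2) w
    = avg n (fun v => g v ^+ 2) w - 2 * a * avg n g w + avg n (fun=> a ^+ 2) w.
  rewrite /avg mulrCA -mulrBr -mulrDr; congr (_ * _).
  by rewrite mulr_sumr -sumrB -big_split /=; apply: eq_bigr => x _; ring.
rewrite avg_cst -/a; nra.
Qed.

(** Let [m] be the infimum of the squared [L^2] norm on the hull and [g] an almost minimiser.
    Averaging does not increase the norm, so [avg n g] and [avg k g] have squared norm at most
    [m + e1], while their midpoint has at least [m]. The parallelogram identity bounds their squared
    distance by [4 e1], and [f] follows because its averages shadow those of [g]. *)
Lemma mean_cauchy f (e : R) : bmeas f -> 0 < e ->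
  exists N, forall n k, (N <= n)%N -> (N <= k)%N ->
    Ex (fun w => (avg n f w - avg k f w) ^+ 2) <= e.
Proof.
move=> bf e0.
pose A : set R := [set Ex (fun w => g w ^+ 2) | g in hull f].
have bh g : hull f g -> bmeas g by exact: bmeas_hull.
have infA : has_inf A.
  split; first by exists (Ex (fun w => f w ^+ 2)); exists f => //; exact: hull_id.
  by exists 0 => _ [g _ <-]; apply: Rintegral_ge0 => w _; exact: sqr_ge0.
(* The square of [x - y + z] is at most three times the sum of the squares: the main term costs
   [3 * 4 * e1] and the two replacements of [f] by [g] cost [3 * 2 * e1], in all [18 * e1]. *)
pose e1 := e / 24.
have e10 : 0 < e1 by rewrite divr_gt0.
have [_ [g hg <-] gm] := inf_adherent e10 infA.
pose m := inf A; rewrite -/m in gm.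
have mle h : hull f h -> m <= Ex (fun w => h w ^+ 2).
  by move=> hh; apply: ge_inf; [case: infA|exists h].
have avg2 n : Ex (fun w => avg n g w ^+ 2) <= m + e1.
  apply: le_trans (ltW gm); rewrite -[leRHS](Ex_avg n (bmeasX2 (bh _ hg))).
  apply: Ex_le => [||w]; last exact: avg_sqr.
    by apply/bmeasX2/bmeas_avg/bh.
  by apply/bmeas_avg/bmeasX2/bh.
have par n k : Ex (fun w => (avg n g w - avg k g w) ^+ 2) <= 4 * e1.
  have hn := hull_avg n hg; have hk := hull_avg k hg.
  have := mle _ (hull_mid hn hk).
  have bn := bmeasX2 (bh _ hn); have bk := bmeasX2 (bh _ hk).
  have bm := bmeasX2 (bh _ (hull_mid hn hk)).
  have -> : Ex (fun w => (avg n g w - avg k g w) ^+ 2)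
     = Ex (fun w => 2 * avg n g w ^+ 2 + 2 * avg k g w ^+ 2
                    - 4 * ((avg n g w + avg k g w) / 2) ^+ 2).
    by apply: eq_Rintegral => w _; field.
  rewrite ExB ?ExD ?ExZ //; try by [exact: bmeasZ|apply: bmeasD; exact: bmeasZ].
  by have := avg2 n; have := avg2 k; lra.
(* A uniform error whose square is at most [e1], obtained without a square root. *)
pose e2 := Num.min 1 e1.
have e20 : 0 < e2 by rewrite lt_min ltr01.
have e2e : e2 ^+ 2 <= e1.
  have : e2 <= 1 by rewrite ge_min lexx.
  have : e2 <= e1 by rewrite ge_min lexx orbT.
  by nra.
have [N _ hN] := avg_hull bf hg e20.
exists N => n k Nn Nk.
pose F w : R := 3 * ((avg n g w - avg k g w) ^+ 2) + 6 * e1.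
have bd : bmeas (fun w => (avg n g w - avg k g w) ^+ 2).
  by apply/bmeasX2/bmeasB; apply/bmeas_avg/bh.
apply: (@le_trans _ _ (Ex F)).
  apply: Ex_le.
  - by apply/bmeasX2/bmeasB; exact: bmeas_avg.
  - by apply: bmeasD; [exact: bmeasZ|exact: bmeas_cst].
  move=> w; have := hN n Nn w; have := hN k Nk w; rewrite /F.
  set a := avg n f w; set b := avg k f w; set a' := avg n g w; set b' := avg k g w.
  have sq (x : R) : `|x| <= e2 -> x ^+ 2 <= e1.
    move=> xe; apply: le_trans e2e; rewrite -real_normK ?num_real //.
    by apply: lerXn2r; rewrite ?nnegrE // ltW.
  move=> /sq h1 /sq h2.
  have -> : a - b = (a' - b') - (a' - a) + (b' - b) by ring.
  move: h1 h2; move: (a' - b') (a' - a) (b' - b) => x y z.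
  have := sqr_ge0 (x + y); have := sqr_ge0 (x - z); have := sqr_ge0 (y + z).
  by nra.
rewrite /F ExD ?ExZ ?Ex_cst //; try by [exact: bmeasZ|exact: bmeas_cst].
have := par n k; rewrite /e1; lra.
Qed.

(** Passage from [L^2] to [L^1] by the pointwise bound [|g| <= (t + g^2 / t) / 2] in place of the
    Cauchy-Schwarz inequality. *)
Lemma Ex_norm_le g (t : R) : bmeas g -> 0 < t -> Ex (fun w => g w ^+ 2) <= t ^+ 2 ->
  Ex (fun w => `|g w|) <= t.
Proof.
move=> bg t0 gt.
have bs : bmeas (fun w => t^-1 * g w ^+ 2) by exact/bmeasZ/bmeasX2.
apply: (@le_trans _ _ (Ex (fun w => 2^-1 * (t + t^-1 * g w ^+ 2)))).
  apply: Ex_le; first exact: bmeas_norm.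
    by apply: bmeasZ; apply: bmeasD => //; exact: bmeas_cst.
  move=> w; rewrite -(ler_pM2l t0) -[g w ^+ 2]real_normK ?num_real //.
  have -> : t * (2^-1 * (t + t^-1 * `|g w| ^+ 2)) = 2^-1 * (t ^+ 2 + `|g w| ^+ 2).
    by field; rewrite gt_eqF.
  have := sqr_ge0 (t - `|g w|); nra.
have bc := @bmeas_cst _ T R t.
rewrite ExZ ?ExD ?ExZ ?Ex_cst //; try by [exact: bmeasX2|exact: bmeasD].
have : t^-1 * Ex (fun w => g w ^+ 2) <= t.
  by rewrite mulrC ler_pdivrMr // -expr2.
lra.
Qed.

(** Borel-Cantelli for geometrically small events; the intersection is their limit superior. *)
Lemma tail_negligible (B : nat -> set T) (c : R) : 0 <= c ->
  (forall i, measurable (B i) /\ (mu (B i) <= (c / (2 ^ i)%:R)%:E)%E) ->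
  mu.-negligible (\bigcap_j \bigcup_(i in ~` `I_j) B i).
Proof.
move=> c0 hB.
have mB i : measurable (B i) by case: (hB i).
have mU j : measurable (\bigcup_(i in ~` `I_j) B i) by exact: bigcup_measurable.
have mI : measurable (\bigcap_j \bigcup_(i in ~` `I_j) B i).
  exact: bigcap_measurableType.
apply/negligibleP => //; apply/eqP; rewrite eq_le measure_ge0 andbT.
apply/lee_addgt0Pr => e e0; rewrite add0e.
have : (fun j => c / 2 ^+ j : R) @ \oo --> (c * 0 : R).
  apply: cvgM; first exact: cvg_cst.
  under eq_fun do rewrite -exprVn.
  by apply: cvg_expr; rewrite ger0_norm ?invr_ge0 // invf_lt1 // ltr1n.
rewrite mulr0 => /cvgr_le /(_ _ e0)[j _ /(_ j (leqnn j)) hj].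
apply: (@le_trans _ _ (c / 2 ^+ j)%:E); last by rewrite lee_fin.
(* The tail starting at [j + 1] is used because its geometric series sums to exactly [c / 2 ^ j]. *)
have sub : \bigcap_j \bigcup_(i in ~` `I_j) B i `<=` \bigcup_(i in ~` `I_j.+1) B i.
  by move=> w; apply.
apply: le_trans (measure_sigma_subadditive_tail mu mB mI sub) _.
rewrite -nneseries_addn; last by move=> i; exact: measure_ge0.
rewrite -(cvg_lim _ (@cvg_geometric_eseries_half _ c j)) //.
apply: lee_nneseries => [i _ _|i _]; first exact: measure_ge0.
by case: (hB (i + j.+1)%N).
Qed.

Theorem ergodic_ae f : bmeas f -> {ae mu, forall w, cvgn (fun n => avg n f w)}.
Proof.
move=> bf; pose q i : R := 2^-1 ^+ i.
have q0 i : 0 < q i by rewrite exprn_gt0 // invr_gt0.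
(* The fourth power gives an [L^1] distance of at most [q i ^+ 2]. The maximal inequality at level
   [q i] then leaves a bad set of measure at most [2 ^ d * q i]: levels and measures are both
   summable. *)
have /choice[N hN] : forall i, exists N, forall n k, (N <= n)%N -> (N <= k)%N ->
    Ex (fun w => (avg n f w - avg k f w) ^+ 2) <= (q i ^+ 2) ^+ 2.
  by move=> i; apply: mean_cauchy => //; rewrite !exprn_gt0.
(* The partial sums make [k] monotone and at least [N]; the summand [i] makes it unbounded. *)
pose k i := (\sum_(j < i.+1) N j + i)%N.
have kN i : (N i <= k i)%N by rewrite /k big_ord_recr /=; lia.
have kS i : (k i <= k i.+1)%N by rewrite /k [in leqRHS]big_ord_recr /=; lia.
have ki i : (i <= k i)%N by rewrite leq_addl.
pose h i := avg (k i) f; pose g i w := `|h i.+1 w - h i w|.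
have bh i : bmeas (h i) by exact: bmeas_avg.
have bg i : bmeas (g i) by apply/bmeas_norm/bmeasB.
have Eg i : Ex (g i) <= q i ^+ 2.
  apply: Ex_norm_le; rewrite ?exprn_gt0 //; first exact: bmeasB.
  by apply: hN => //; exact: leq_trans (kS i).
pose B i := \bigcup_M maxbad M (q i) (g i).
have hB i : measurable (B i) /\ (mu (B i) <= ((2 ^ d)%:R / (2 ^ i)%:R)%:E)%E.
  apply: maximal_ineq_all => //; first by move=> v; exact: normr_ge0.
  have -> : q i * ((2 ^ d)%:R / (2 ^ i)%:R) = (2 ^ d)%:R * q i ^+ 2.
    by rewrite /q [(2 ^ i)%:R]natrX exprVn; ring.
  by rewrite ler_wpM2l.
apply: negligibleS (tail_negligible _ hB) => //.
move=> w; apply: contra_notP => /existsNP[j0 hj0].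
have good i n : (j0 <= i)%N -> avg n (g i) w <= q i.
  move=> ij; rewrite leNgt; apply/negP => hlt; apply: hj0.
  move=> _; exists i; last by exists n => //; exists n.
  by rewrite /=; apply/negP; rewrite -leqNgt.
(* The right-hand side is the geometric sum of [q l] for [j <= l < j + i]. The bound holds for all
   [n] at once, which is what the maximal function provides. *)
have tele n j i : (j0 <= j)%N ->
    `|avg n (h (j + i)%N) w - avg n (h j) w| <= 2 * (q j - q (j + i)%N).
  move=> jj; elim: i => [|i IH]; first by rewrite addn0 !subrr normr0 mulr0.
  rewrite -(subrKA (avg n (h (j + i)%N) w)); apply: le_trans (ler_normD _ _) _.
  have : `|avg n (h (j + i.+1)%N) w - avg n (h (j + i)%N) w| <= q (j + i)%N.
    rewrite -avgB; apply: le_trans (avg_norm _ _ _) _; rewrite addnS.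
    by apply: good; exact: leq_trans (leq_addr _ _).
  have -> : q (j + i.+1)%N = q (j + i)%N / 2 by rewrite addnS /q exprS mulrC.
  lra.
apply: cvgn_cauchy => e e0.
have [J _ hJ] : \forall j \near \oo, q j <= e / 16.
  have : q @ \oo --> (0 : R).
    by apply: cvg_expr; rewrite ger0_norm ?invr_ge0 // invf_lt1 // ltr1n.
  by move/cvgr_le; apply; rewrite divr_gt0.
pose j := (j0 + J)%N.
have {hJ} qj : q j <= e / 16 by apply: hJ => /=; rewrite leq_addl.
have e8 : 0 < e / 8 by rewrite divr_gt0.
have [N1 _ hN1] : \forall n \near \oo, forall w, `|avg n (h j) w - avg n f w| <= e / 8.
  by apply: filterS (avg_flat (k j) bf e8) => n hn v; rewrite avg_comm.
(* The threshold [N1] depends on [j] alone, whereas [i] is chosen after [n] and [p], so large that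
   averaging over either box barely moves [h (j + i)]. The value [h (j + i) w] then links
   [avg n f w] to [avg p f w] through six errors of at most [e / 8]. *)
exists N1 => n p Nn Np.
have [K1 _ hK1] := avg_flat n bf e8.
have [K2 _ hK2] := avg_flat p bf e8.
pose i := (K1 + K2)%N.
have in1 : (K1 <= k (j + i))%N by apply: leq_trans (ki _); rewrite /i; lia.
have in2 : (K2 <= k (j + i))%N by apply: leq_trans (ki _); rewrite /i; lia.
have := hN1 n Nn w; have := hN1 p Np w.
have := hK1 _ in1 w; have := hK2 _ in2 w; rewrite -/(h _).
have jj : (j0 <= j)%N by rewrite leq_addr.
have := tele n j i jj; have := tele p j i jj; have := q0 (j + i)%N.
rewrite !ler_norml => ? /andP[? ?] /andP[? ?] /andP[? ?] /andP[? ?] /andP[? ?] /andP[? ?].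
apply/andP; split; lra.
Qed.

End Ergodic.

(** * Entropy of finite distributions *)

Section FiniteEntropy.
Variable R : realType.
Implicit Types U V W : finType.

Definition push U V (g : U -> V) (p : U -> R) (v : V) : R := \sum_(u | g u == v) p u.
Definition ent U (p : U -> R) : R := - \sum_u p u * ln (p u).
(* As [ln 0 = 0], this is the relative entropy only when [abscont p q]. *)
Definition kl U (p q : U -> R) : R := \sum_u p u * (ln (p u) - ln (q u)).
Definition abscont U (p q : U -> R) : Prop := forall u, q u = 0 -> p u = 0.

Lemma push_ge0 U V (g : U -> V) p v : (forall u, 0 <= p u) -> 0 <= push g p v.
Proof. by move=> p0; exact: sumr_ge0. Qed.

Lemma sum_push U V (g : U -> V) p (G : V -> R) :
  \sum_v push g p v * G v = \sum_u p u * G (g u).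
Proof.
rewrite [RHS](partition_big g xpredT) //=; apply: eq_bigr => v _.
by rewrite mulr_suml; apply: eq_bigr => u /eqP ->.
Qed.

Lemma sum_push1 U V (g : U -> V) p : \sum_v push g p v = \sum_u p u.
Proof.
have := sum_push g p (fun=> 1).
by under eq_bigr do rewrite mulr1; under [X in _ = X -> _]eq_bigr do rewrite mulr1.
Qed.

Lemma push_ge U V (g : U -> V) p u : (forall u, 0 <= p u) -> p u <= push g p (g u).
Proof. by move=> p0; rewrite /push (bigD1 u) //= lerDl sumr_ge0. Qed.

Lemma push_eq0 U V (g : U -> V) p u : (forall u, 0 <= p u) ->
  push g p (g u) = 0 -> p u = 0.
Proof. by move=> p0 h; apply/eqP; rewrite eq_le p0 andbT -h push_ge. Qed.

Lemma abscont_push U V (g : U -> V) p q : (forall u, 0 <= q u) ->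
  abscont p q -> abscont (push g p) (push g q).
Proof.
move=> q0 pq v qv; apply: big1 => u /eqP guv; apply: pq.
by apply: (@push_eq0 _ _ g) => //; rewrite guv.
Qed.

(** From [ln x <= x - 1] at [x = q u / p u]. Only an inequality between the total masses is asked,
    which is the form that [kl_push] supplies. *)
Lemma gibbs U (p q : U -> R) : (forall u, 0 <= p u) -> (forall u, 0 <= q u) ->
  abscont p q -> \sum_u q u <= \sum_u p u ->
  \sum_u p u * ln (q u) <= \sum_u p u * ln (p u).
Proof.
move=> p0 q0 pq sqp; rewrite -subr_le0 -sumrB.
apply: (@le_trans _ _ (\sum_u (q u - p u))); last by rewrite sumrB subr_le0.
apply: ler_sum => u _.
have [->|pu0] := eqVneq (p u) 0; first by rewrite !mul0r !subr0.
have pu : 0 < p u by rewrite lt_def pu0 p0.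
have qu : 0 < q u by rewrite lt_def q0 andbT; apply: contra_neq pu0; exact: pq.
rewrite -mulrBr -ln_div ?posrE //.
have h : 0 < q u / p u by rewrite divr_gt0.
apply: (@le_trans _ _ (p u * (q u / p u - 1))).
  rewrite ler_wpM2l //; have := @le_ln1Dx R (q u / p u - 1).
  by rewrite [1 + _]addrC subrK; apply; lra.
by rewrite mulrBr mulr1 mulrC divfK.
Qed.

Lemma ent_push U V (g : U -> V) p : (forall u, 0 <= p u) -> ent (push g p) <= ent p.
Proof.
move=> p0; rewrite lerN2 sum_push; apply: ler_sum => u _.
have [->|pu0] := eqVneq (p u) 0; first by rewrite !mul0r.
have pu : 0 < p u by rewrite lt_def pu0 p0.
rewrite ler_wpM2l // ler_ln ?posrE //; first exact: push_ge.
exact: lt_le_trans (push_ge g u p0).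
Qed.

(** Gibbs inequality against the product of the two marginals. *)
Lemma ent_pair U V (p : U * V -> R) : (forall u, 0 <= p u) -> \sum_u p u = 1 ->
  ent p <= ent (push fst p) + ent (push snd p).
Proof.
move=> p0 p1; rewrite -opprD lerN2 !sum_push -big_split /=.
set p' := push fst p; set p'' := push snd p.
apply: (@le_trans _ _ (\sum_u p u * ln (p' u.1 * p'' u.2))).
  apply: ler_sum => u _; rewrite -mulrDr.
  have [->|pu0] := eqVneq (p u) 0; first by rewrite !mul0r.
  have pu : 0 < p u by rewrite lt_def pu0 p0.
  by rewrite lnM ?posrE //; exact: lt_le_trans (push_ge _ u p0).
apply: gibbs => // [u|u|].
- by rewrite mulr_ge0 ?push_ge0.
- by move=> /eqP; rewrite mulf_eq0 => /orP[]/eqP; exact: push_eq0.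
rewrite -(pair_bigA _ (fun a b => p' a * p'' b)) /=.
under eq_bigr do rewrite -mulr_sumr sum_push1 p1 mulr1.
by rewrite sum_push1 p1.
Qed.

Lemma ent_le_card U (p : U -> R) : (forall u, 0 <= p u) -> \sum_u p u = 1 ->
  ent p <= ln #|U|%:R.
Proof.
move=> p0 p1.
have U0 : (0 < #|U|)%N.
  rewrite lt0n; apply/negP => /eqP U0.
  have : \sum_u p u = 0 by apply: big1 => u; have := card0_eq U0 u.
  by rewrite p1 => /eqP; rewrite oner_eq0.
have U0' : (0 : R) < #|U|%:R by rewrite ltr0n.
rewrite lerNl.
have := @gibbs U p (fun=> #|U|%:R^-1) p0.
rewrite -mulr_suml p1 mul1r lnV ?posrE //; apply.
- by move=> _; rewrite invr_ge0.
- by move=> u /eqP; rewrite invr_eq0 gt_eqF.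
by rewrite sumr_const -[X in X <= _]mulr_natl mulfV ?gt_eqF.
Qed.

Lemma ent_ge0 U (p : U -> R) : (forall u, 0 <= p u) -> \sum_u p u = 1 -> 0 <= ent p.
Proof.
move=> p0 p1; rewrite oppr_ge0; apply: sumr_le0 => u _.
rewrite mulr_ge0_le0 // ln_le0 // -p1 (bigD1 u) //= lerDl sumr_ge0 //.
Qed.

(** Data processing. The comparison weight [qt] keeps the conditional law of [q] on each fibre of
    [g] but gives the fibres the masses of [p]. The left side is the mean of [ln (qt u) - ln (q u)]
    under [p], and the Gibbs inequality allows [qt] to be replaced by [p]. *)
Lemma kl_push U V (g : U -> V) p q : (forall u, 0 <= p u) -> (forall u, 0 <= q u) ->
  abscont p q -> kl (push g p) (push g q) <= kl p q.
Proof.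
move=> p0 q0 pq; rewrite /kl sum_push.
set p' := push g p; set q' := push g q.
pose qt u := q u * (p' (g u) / q' (g u)).
have -> : \sum_u p u * (ln (p' (g u)) - ln (q' (g u)))
    = \sum_u p u * ln (qt u) - \sum_u p u * ln (q u).
  rewrite -sumrB; apply: eq_bigr => u _; rewrite -mulrBr.
  have [->|pu0] := eqVneq (p u) 0; first by rewrite !mul0r.
  have pu : 0 < p u by rewrite lt_def pu0 p0.
  have qu : 0 < q u by rewrite lt_def q0 andbT; apply: contra_neq pu0; exact: pq.
  have p'u : 0 < p' (g u) by apply: lt_le_trans (push_ge _ _ _).
  have q'u : 0 < q' (g u) by apply: lt_le_trans (push_ge _ _ _).
  rewrite lnM ?posrE ?divr_gt0 // ln_div ?posrE //; ring.
have -> : \sum_u p u * (ln (p u) - ln (q u)) = \sum_u p u * ln (p u) - \sum_u p u * ln (q u).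
  by rewrite -sumrB; apply: eq_bigr => u _; rewrite mulrBr.
rewrite lerD2r; apply: gibbs => // [u|u|].
- by rewrite mulr_ge0 // divr_ge0 // push_ge0.
- move=> /eqP; rewrite !mulf_eq0 invr_eq0 => /or3P[]/eqP.
  + exact: pq.
  + exact: push_eq0.
  + by move=> h; apply: pq; exact: push_eq0 h.
have := sum_push g q (fun v => p' v / q' v); rewrite -/q' => <-.
rewrite -(sum_push1 g p); apply: ler_sum => v _.
have [->|qv] := eqVneq (q' v) 0; first by rewrite mul0r push_ge0.
by rewrite mulrC divfK.
Qed.

(** Relative entropy is minus the entropy of [p] minus the mean of [ln q]. Subadditivity of entropy
    treats the first term, and the bound of [q] by the product of its marginals treats the second at
    cost [c]. *)
Lemma kl_pair U V (p q : U * V -> R) (c : R) :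
  (forall u, 0 <= p u) -> \sum_u p u = 1 -> (forall u, 0 <= q u) -> abscont p q ->
  (forall u, q u <= expR c * (push fst q u.1 * push snd q u.2)) ->
  kl (push fst p) (push fst q) + kl (push snd p) (push snd q) - c <= kl p q.
Proof.
move=> p0 p1 q0 pq qc; have := ent_pair p0 p1; rewrite /ent /kl !sum_push.
set p' := push fst p; set p'' := push snd p; set q' := push fst q; set q'' := push snd q.
have : \sum_u p u * ln (q u) <= c + \sum_u p u * ln (q' u.1) + \sum_u p u * ln (q'' u.2).
  rewrite -[c]mul1r -p1 mulr_suml -!big_split /=; apply: ler_sum => u _.
  rewrite -!mulrDr.
  have [->|pu0] := eqVneq (p u) 0; first by rewrite !mul0r.
  have pu : 0 < p u by rewrite lt_def pu0 p0.
  have qu : 0 < q u by rewrite lt_def q0 andbT; apply: contra_neq pu0; exact: pq.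
  have q'u : 0 < q' u.1 by apply: lt_le_trans (push_ge _ _ _).
  have q''u : 0 < q'' u.2 by apply: lt_le_trans (push_ge _ _ _).
  rewrite ler_wpM2l // -[X in X + _ + _]expRK -!lnM ?posrE ?mulr_gt0 ?expR_gt0 //.
  by rewrite -mulrA ler_ln ?posrE ?mulr_gt0 ?expR_gt0.
have sB (F G : U * V -> R) : \sum_u p u * (F u - G u)
    = \sum_u p u * F u - \sum_u p u * G u.
  by rewrite -sumrB; apply: eq_bigr => u _; rewrite mulrBr.
rewrite !sB; lra.
Qed.

Lemma sum_relterm U (p q : U -> R) : (forall u, 0 <= p u) -> (forall u, 0 <= q u) ->
  abscont p q -> (\sum_u relterm (p u) (q u))%E = (kl p q)%:E.
Proof.
move=> p0 q0 pq; rewrite -sumEFin; apply: eq_bigr => u _; rewrite /relterm.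
have [->|pu0] := eqVneq (p u) 0; first by rewrite mul0r.
have qu0 : q u != 0 by apply: contra_neq pu0; exact: pq.
by rewrite (negbTE qu0) ln_div ?posrE // lt_def ?pu0 ?p0 ?qu0 ?q0.
Qed.

Lemma sum_relterm_infty U (p q : U -> R) u : p u != 0 -> q u = 0 ->
  (\sum_u relterm (p u) (q u))%E = +oo%E.
Proof.
move=> pu qu; apply/eqP; rewrite esum_eqy.
  by apply/existsP; exists u => /=; rewrite /relterm (negbTE pu) qu !eqxx.
by move=> v _; rewrite /relterm; case: ifP => // _; case: ifP.
Qed.

Lemma sum_entterm U (p : U -> R) : (\sum_u entterm (p u))%E = (ent p)%:E.
Proof.
rewrite /ent -sumrN -sumEFin; apply: eq_bigr => u _; rewrite /entterm.
by case: eqVneq => [->|//]; rewrite mul0r oppr0.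
Qed.

End FiniteEntropy.

(** * Entropy densities of translation-invariant measures *)

Section FiniteRV.
Context {disp : measure_display} {Om : measurableType disp} {R : realType}.
Implicit Types U V : finType.

(** Measurability tested on atoms, so that a finite type needs no sigma-algebra of its own. *)
Definition fmeas U (f : Om -> U) : Prop := forall u, measurable (f @^-1` [set u]).

Lemma fmeas_comp U V (g : U -> V) (f : Om -> U) : fmeas f -> fmeas (g \o f).
Proof.
move=> mf v.
have -> : (g \o f) @^-1` [set v] = \bigcup_(u in [set u | g u = v]) f @^-1` [set u].
  by apply/seteqP; split=> [w /= gfw|w [u /= guv fwu]]; [exists (f w)|rewrite fwu].
by apply: fin_bigcup_measurable => //; exact: finite_finset.
Qed.

Lemma fmeas_pair U V (f : Om -> U) (g : Om -> V) : fmeas f -> fmeas g ->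
  fmeas (fun w => (f w, g w)).
Proof.
move=> mf mg [u v].
have -> : (fun w => (f w, g w)) @^-1` [set (u, v)] = f @^-1` [set u] `&` g @^-1` [set v].
  by apply/seteqP; split=> [w [/= -> ->]|w [/= -> ->]].
exact: measurableI.
Qed.

Variable mu : probability Om R.
Local Notation Ex f := (\int[mu]_w f w).

Definition pr U (f : Om -> U) (u : U) : R := fine (mu (f @^-1` [set u])).

Lemma pr_ge0 U (f : Om -> U) u : 0 <= pr f u.
Proof. by rewrite fine_ge0. Qed.

Lemma fin_sum_indic U (f : Om -> U) (G : U -> R) w :
  G (f w) = \sum_u G u * \1_(f @^-1` [set u]) w.
Proof.
rewrite (bigD1 (f w)) //= big1 ?addr0 => [|u uf].
  by rewrite indicE mem_set // mulr1.
by rewrite indicE memNset ?mulr0 //= => e; rewrite e eqxx in uf.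
Qed.

Lemma bmeas_fin U (f : Om -> U) (G : U -> R) : fmeas f -> bmeas (fun w => G (f w)).
Proof.
move=> mf; rewrite (funext (fin_sum_indic f G)).
by apply: bmeas_sum => u; apply/bmeasZ/bmeas_indic.
Qed.

Lemma Ex_fin U (f : Om -> U) (G : U -> R) : fmeas f ->
  Ex (fun w => G (f w)) = \sum_u pr f u * G u.
Proof.
move=> mf; have bI u := bmeas_indic (mf u).
rewrite (funext (fin_sum_indic f G)) Ex_sum; last by move=> u; exact/bmeasZ.
by apply: eq_bigr => u _; rewrite ExZ // Ex_indic // mulrC.
Qed.

Lemma pr_sum1 U (f : Om -> U) : fmeas f -> \sum_u pr f u = 1.
Proof.
move=> mf; have := Ex_fin (fun=> 1) mf; rewrite Ex_cst => ->.
by apply: eq_bigr => u _; rewrite mulr1.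
Qed.

Lemma pr_comp U V (g : U -> V) (f : Om -> U) v : fmeas f ->
  pr (g \o f) v = push g (pr f) v.
Proof.
move=> mf.
have := Ex_fin (fun u => (g u == v)%:R) mf.
have -> : (fun w => (g (f w) == v)%:R : R) = (fun w => \1_((g \o f) @^-1` [set v]) w).
  apply/funext => w; rewrite indicE; congr (nat_of_bool _)%:R.
  by apply/eqP/idP => [h|/set_mem//]; exact/mem_set.
rewrite Ex_indic; last exact: fmeas_comp.
rewrite -/(pr _ _) => ->; rewrite /push [RHS]big_mkcond /=.
by apply: eq_bigr => u _; case: eqP; rewrite ?mulr1 ?mulr0.
Qed.

End FiniteRV.

(** * Laws of finite patterns and block entropies *)

Section Cylinders.
Variables (R : realType) (d : nat).
Implicit Types (T : FinPointed.type) (L A B : {fset site d}).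

Definition rst (T : Type) L (w : cfg d T) : {ffun L -> T} := [ffun x => w (val x)].

Lemma cyl_preimage (T : Type) L (z : {ffun L -> T}) : cyl z = rst L @^-1` [set z].
Proof.
apply/seteqP; split=> w /= h; first by apply/ffunP => x; rewrite ffunE h.
by move=> x; rewrite -h ffunE.
Qed.

Lemma cyl_sigma T (S : set (site d)) L (z : {ffun L -> T}) :
  (forall x, x \in L -> S x) -> <<s @coordsets d T S >> (cyl z).
Proof.
move=> LS.
have -> : cyl z = \bigcap_(x in [set: L]) [set w | w (val x) = z x].
  by apply/seteqP; split=> w h x //; [move=> _|]; exact: h.
apply: (@fin_bigcap_measurable _ (g_sigma_algebraType (@coordsets d T S))).
  exact: finite_finset.
move=> x _; apply: sub_sigma_algebra; exists (val x), (z x).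
by split=> //; apply: LS; exact: valP.
Qed.

Lemma fmeas_rst T L : fmeas (rst L : cfgm d T -> {ffun L -> T}).
Proof. by move=> z; rewrite -cyl_preimage; exact: cyl_sigma. Qed.

Lemma cylpE T (mu : probability (cfgm d T) R) L (z : {ffun L -> T}) :
  cylp mu z = pr mu (rst L) z.
Proof. by rewrite /cylp cyl_preimage. Qed.

Lemma shift_measurable T x : measurable_fun [set: cfgm d T] (shift x : cfgm d T -> cfgm d T).
Proof.
apply: (@measurability _ _ (cfgm d T) (cfgm d T) setT (shift x) (@coordsets d T setT)) => //.
move=> _ [C [y [a [_ ->]]] <-]; rewrite setTI.
by apply: sub_sigma_algebra; exists (x + y), a.
Qed.

Lemma shiftD (T : Type) x y (w : cfg d T) : shift x (shift y w) = shift (x + y) w.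
Proof. by apply/funext => z; rewrite /shift addrA (addrC y). Qed.

(** Reads a pattern on [L'] off a pattern on [L] after translation by [x]. The default [point] is
    never reached when [L' + x] lies in [L]. *)
Definition trunc T L L' x (z : {ffun L -> T}) : {ffun L' -> T} :=
  [ffun y => glue z (fun=> point) (val y + x)].

Lemma glueE (T : Type) L (z : {ffun L -> T}) (w : cfg d T) y (yL : y \in L) :
  glue z w y = z [` yL]%fset.
Proof. by rewrite /glue insubT. Qed.

Lemma glue_in (T : Type) L (w v : cfg d T) y : y \in L -> glue (rst L w) v y = w y.
Proof. by move=> yL; rewrite glueE ffunE. Qed.

Lemma glue_out (T : Type) L (z : {ffun L -> T}) (w : cfg d T) y : y \notin L -> glue z w y = w y.
Proof. by move=> yL; rewrite /glue insubN. Qed.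

Lemma rst_glue (T : Type) L (z : {ffun L -> T}) (w : cfg d T) : rst L (glue z w) = z.
Proof. by apply/ffunP => -[x xL]; rewrite ffunE (glueE z w xL). Qed.

Lemma rst_shift T L L' x (w : cfg d T) : (forall y, y \in L' -> y + x \in L) ->
  rst L' (shift x w) = trunc L' x (rst L w).
Proof.
move=> h; apply/ffunP => y; rewrite !ffunE glue_in; last by apply: h; exact: valP.
by rewrite /Defs.shift addrC.
Qed.

Section Measure.
Variables (T : FinPointed.type) (mu : probability (cfgm d T) R).
Hypothesis mu_inv : trans_inv_meas mu.

Lemma pr_shift (U : finType) (f : cfgm d T -> U) x : fmeas f ->
  pr mu (fun w => f (shift x w)) =1 pr mu f.
Proof. by move=> mf u; rewrite /pr -(mu_inv x (mf u)). Qed.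

Lemma pr_trunc L L' x : (forall y, y \in L' -> y + x \in L) ->
  pr mu (rst L') =1 push (trunc L' x) (pr mu (rst L)).
Proof.
move=> h z; rewrite -(pr_shift x (@fmeas_rst T L')) -pr_comp; last exact: fmeas_rst.
by congr (pr mu _ z); apply/funext => w; exact: rst_shift.
Qed.

Definition entL L : R := ent (pr mu (rst L)).

Lemma eq_ent (U : finType) (p q : U -> R) : p =1 q -> ent p = ent q.
Proof. by move=> pq; congr (- _); apply: eq_bigr => u _; rewrite pq. Qed.

Lemma entL_mono L L' x : (forall y, y \in L' -> y + x \in L) -> entL L' <= entL L.
Proof.
by move=> h; rewrite /entL (eq_ent (pr_trunc h)); apply: ent_push => z; exact: pr_ge0.
Qed.

(** The pattern on the union is a function of the pair of patterns, also when [A] and [B] overlap: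
    the value from [A] takes precedence. *)
Lemma entL_sub A B : entL (A `|` B)%fset <= entL A + entL B.
Proof.
pose pAB (w : cfgm d T) := (rst A w, rst B w).
pose h (z : {ffun A -> T} * {ffun B -> T}) : {ffun (A `|` B)%fset -> T} :=
  rst _ (glue z.1 (glue z.2 (fun=> point))).
have mAB : fmeas pAB by apply: fmeas_pair; exact: fmeas_rst.
have e1 : pr mu (rst (A `|` B)%fset) =1 push h (pr mu pAB).
  move=> z; rewrite -pr_comp //; congr (pr mu _ z); apply/funext => w.
  apply/ffunP => -[x xAB]; rewrite !ffunE /=.
  have [xA|xA] := boolP (x \in A); first by rewrite glue_in.
  by rewrite glue_out // glue_in //; move: xAB; rewrite inE (negbTE xA).
have eA : pr mu (rst A) =1 push fst (pr mu pAB) by move=> z; rewrite -pr_comp.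
have eB : pr mu (rst B) =1 push snd (pr mu pAB) by move=> z; rewrite -pr_comp.
rewrite /entL (eq_ent e1) (eq_ent eA) (eq_ent eB).
apply: le_trans (ent_push _ _) (ent_pair _ _); try by move=> u; exact: pr_ge0.
exact: pr_sum1.
Qed.

Lemma entL_le L : entL L <= ln #|T|%:R * #|` L|%:R.
Proof.
apply: le_trans (ent_le_card _ _) _.
- by move=> z; exact: pr_ge0.
- by apply: pr_sum1; exact: fmeas_rst.
rewrite card_ffun -cardfE natrX lnXn; first by rewrite mulr_natr.
by rewrite ltr0n; apply/card_gt0P; exists point.
Qed.

Lemma entL_ge0 L : 0 <= entL L.
Proof. by apply: ent_ge0 => [z|]; [exact: pr_ge0|by apply: pr_sum1; exact: fmeas_rst]. Qed.

Lemma entL_tiles m (U : seq (site d)) :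
  entL (tiles m m U) <= (size U)%:R * entL (box d m).
Proof.
elim: U => [|u U IH].
  rewrite mul0r /tiles big_nil; apply: le_trans (entL_le _) _.
  by rewrite cardfs0 mulr0.
rewrite tiles_cons /= -natr1 mulrDl mul1r addrC.
apply: le_trans (entL_sub _ _) (lerD _ IH).
apply: (@entL_mono _ _ (- (u *+ m.*2.+1))) => y; by rewrite in_fshift.
Qed.

End Measure.
End Cylinders.

(** * Limits of almost superadditive sequences *)

Section Fekete.
Variable R : realType.

(* [v m] is a lower estimate for all late [u n] and a good upper estimate for [u m]: then
   [u] converges, possibly to [+oo], to the supremum of [v]. *)
Lemma fekete_sup (u v alpha beta : nat -> R) :
  (forall m e, 0 < e -> \forall n \near \oo, v m - e <= u n) ->
  (forall m, u m <= alpha m * v m + beta m) -> (forall m, 0 <= alpha m) ->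
  alpha @ \oo --> (1 : R) -> beta @ \oo --> (0 : R) ->
  exists l : \bar R, (u n)%:E @[n --> \oo] --> l.
Proof.
move=> H1 H2 a0 a1 b0.
pose s := ereal_sup (range (fun m => (v m)%:E)).
have vs m : ((v m)%:E <= s)%E by apply: ereal_sup_ubound; exists m.
exists s; case es : s => [r| |].
- apply/fine_cvgP; split; first exact: nearW.
  apply/cvgrPdist_le => e e0; rewrite /=.
  have [_ [m _ <-] hm] : exists2 x, range (fun m => (v m)%:E) x & ((r - e / 2)%:E < x)%E.
    by apply: ereal_sup_gt; rewrite -/s es lte_fin ltrBlDr ltrDl divr_gt0.
  rewrite lte_fin in hm.
  have vr k : v k <= r by have := vs k; rewrite es lee_fin.
  have h1 := H1 m _ (divr_gt0 e0 (ltr0Sn _ 1)).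
  have ab : (fun n => alpha n * r + beta n) @ \oo --> (1 * r + 0 : R).
    by apply: cvgD => //; apply: cvgM => //; exact: cvg_cst.
  have h2 : \forall n \near \oo, alpha n * r + beta n <= r + e.
    by move/cvgr_le : ab; apply; rewrite addr0 mul1r ltrDl.
  near=> n; rewrite ler_norml; apply/andP; split.
    have : alpha n * r + beta n <= r + e by near: n.
    have := H2 n; have := ler_wpM2l (a0 n) (vr n); lra.
  have : v m - e / 2 <= u n by near: n.
  lra.
- apply/cvgeyPge => A.
  have [_ [m _ <-] hm] : exists2 x, range (fun m => (v m)%:E) x & ((A + 1)%:E < x)%E.
    by apply: ereal_sup_gt; rewrite -/s es ltry.
  rewrite lte_fin in hm.
  apply: filterS (H1 m 1 ltr01) => n h; rewrite lee_fin; lra.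
- by have := vs 0%N; rewrite es.
Unshelve. all: by end_near. Qed.

(** Exact tilings exist only for the radii [M + (2 M + 1) k]. Any large [n] is within one period of
    such a radius, and the shell in between has negligible volume. *)
Lemma near_tile d M (e : R) : 0 < e -> \forall n \near \oo,
  exists k, (M + M.*2.+1 * k <= n <= M + M.*2.+1 * k + M.*2.+1)%N /\
    (boxcard d n)%:R <= (1 + e) * (boxcard d (M + M.*2.+1 * k))%:R :> R.
Proof.
move=> e0; have hs := @box_shrink d R M.*2.+1 e e0; near=> n.
have Mn : (M <= n)%N by near: n; exact: nbhs_infty_ge.
exists ((n - M) %/ M.*2.+1)%N; have := divn_eq (n - M) M.*2.+1.
have := ltn_pmod (n - M) (ltn0Sn M.*2); set k := (_ %/ _)%N => h1 h2.
split; first by apply/andP; split; nia.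
apply: (@le_trans _ _ ((1 + e) * (boxcard d (n - M.*2.+1))%:R)).
  by near: n.
rewrite ler_wpM2l ?addr_ge0 ?(ltW e0) // vol_le //; nia.
Unshelve. all: by end_near. Qed.

End Fekete.

Section EntropyLimit.
Variables (R : realType) (d : nat) (T : FinPointed.type) (mu : probability (cfgm d T) R).
Hypothesis mu_inv : trans_inv_meas mu.
Local Notation vol n := ((boxcard d n)%:R : R).

Lemma ent_seqE n : ent_seq mu n = (entL mu (box d n) / vol n)%:E.
Proof.
rewrite /ent_seq; under eq_bigr do rewrite cylpE.
by rewrite sum_entterm -EFinM mulrC.
Qed.

(** A large box is a tiled box plus a thin shell whose sites cost at most [ln #|T|] each. *)
Lemma entL_box_near m (e : R) : 0 < e -> \forall n \near \oo,
  entL mu (box d n) / vol n <= entL mu (box d m) / vol m + e.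
Proof.
move=> e0; pose C : R := ln #|T|%:R.
have C0 : 0 <= C by rewrite ln_ge0 // ler1n; apply/card_gt0P; exists point.
have e'0 : 0 < e / (C + 1) by rewrite divr_gt0 // ltr_wpDl.
apply: filterS (near_tile d m e'0) => n [k [/andP[kn _] hn]].
set nk := (m + m.*2.+1 * k)%N in kn hn.
have sub := sub_box d kn.
have h1 : entL mu (box d n) <= entL mu (box d nk) + C * (vol n - vol nk).
  rewrite [in leLHS](fsubset_split sub); apply: le_trans (entL_sub _ _ _) _.
  rewrite lerD2l; apply: le_trans (entL_le _ _) _.
  by rewrite cardfsDS // natrB // leq_boxcard.
have h2 : entL mu (box d nk) <= vol nk * (entL mu (box d m) / vol m).
  rewrite /nk -tiles_box; apply: le_trans (entL_tiles mu_inv _ _) _.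
  by rewrite boxcard_mul natrM -mulrA [X in _ <= _ * X]mulrC divfK ?vol_neq0.
rewrite ler_pdivrMr ?vol_gt0 //; apply: le_trans h1 _.
set a := entL mu (box d m) / vol m in h2 *.
have a0 : 0 <= a by rewrite divr_ge0 // entL_ge0.
have nkn : vol nk <= vol n by exact: vol_le.
have h3 : C * (vol n - vol nk) <= e * vol n.
  apply: (@le_trans _ _ (C * (e / (C + 1) * vol n))).
    rewrite ler_wpM2l // lerBlDl; apply: le_trans hn _.
    by rewrite mulrDl mul1r lerD2l ler_wpM2l // ltW.
  rewrite !mulrA ler_wpM2r // ler_pdivrMr ?ltr_wpDl //.
  by rewrite mulrC ler_wpM2l ?(ltW e0) // lerDl.
have := ler_wpM2r a0 nkn; rewrite mulrDl; lra.
Qed.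

(** Entropy is subadditive, so the superadditive criterion is applied to its negative. The bounds 0
    and [ln #|T|] per site make the limit finite. *)
Lemma ent_cvg : exists b : R, ent_seq mu n @[n --> \oo] --> b%:E.
Proof.
pose u n := - (entL mu (box d n) / vol n).
have [l ul] : exists l : \bar R, (u n)%:E @[n --> \oo] --> l.
  apply: (@fekete_sup _ u u (fun=> 1) (fun=> 0)).
  - by move=> m e e0; apply: filterS (entL_box_near m e0) => n h; rewrite /u; lra.
  - by move=> m; rewrite mul1r addr0.
  - by move=> m.
  - exact: cvg_cst.
  - exact: cvg_cst.
have lfin : l \is a fin_num.
  rewrite fin_numElt; apply/andP; split.
    apply: (@lt_le_trans _ _ (- ln #|T|%:R)%:E); first by rewrite ltNyr.
    apply: (cvge_ge _ ul); apply: nearW => n; rewrite lee_fin lerN2.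
    by rewrite ler_pdivrMr ?vol_gt0 // entL_le.
  apply: (@le_lt_trans _ _ 0%E) => //.
  apply: (cvge_le _ ul); apply: nearW => n.
  by rewrite lee_fin oppr_le0 divr_ge0 // entL_ge0.
exists (- fine l); rewrite EFinN fineK //.
under eq_fun do rewrite ent_seqE.
have -> : (fun n => (entL mu (box d n) / vol n)%:E) = (fun n => - (u n)%:E)%E.
  by apply/funext => n; rewrite -EFinN opprK.
exact: cvgeN.
Qed.

End EntropyLimit.

(** * Relative entropy density under decoupling *)

Section RelativeEntropyLimit.
Variables (R : realType) (d : nat) (T : FinPointed.type) (mu nu : probability (cfgm d T) R).
Hypotheses (mu_inv : trans_inv_meas mu) (nu_inv : trans_inv_meas nu).
Local Notation vol n := ((boxcard d n)%:R : R).

Definition klL (L : {fset site d}) : R := kl (pr mu (rst L)) (pr nu (rst L)).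
Definition acL (L : {fset site d}) : Prop := abscont (pr mu (rst L)) (pr nu (rst L)).

Lemma eq_kl (U : finType) (p q p' q' : U -> R) : p =1 p' -> q =1 q' -> kl p q = kl p' q'.
Proof. by move=> pp qq; apply: eq_bigr => u _; rewrite pp qq. Qed.

Lemma acL_mono L L' x : (forall y, y \in L' -> y + x \in L) -> acL L -> acL L'.
Proof.
move=> h ac z; rewrite (pr_trunc mu_inv h) (pr_trunc nu_inv h).
by apply: abscont_push ac _ => u; exact: pr_ge0.
Qed.

Lemma klL_mono L L' x : (forall y, y \in L' -> y + x \in L) -> acL L -> klL L' <= klL L.
Proof.
move=> h ac; rewrite /klL (eq_kl (pr_trunc mu_inv h) (pr_trunc nu_inv h)).
by apply: kl_push => // u; exact: pr_ge0.
Qed.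

Lemma klL_ge0 L : acL L -> 0 <= klL L.
Proof.
move=> ac; have mL := @fmeas_rst d T L.
have := gibbs (fun u => pr_ge0 mu (rst L) u) (fun u => pr_ge0 nu (rst L) u) ac.
rewrite !pr_sum1 // => /(_ (lexx _)); rewrite -subr_ge0 -sumrB.
by under eq_bigr do rewrite -mulrBr.
Qed.

Lemma relent_seqE n : acL (box d n) -> relent_seq mu nu n = (klL (box d n) / vol n)%:E.
Proof.
move=> ac; rewrite /relent_seq; under eq_bigr do rewrite !cylpE.
rewrite (sum_relterm (fun u => pr_ge0 mu _ u) (fun u => pr_ge0 nu _ u) ac) -EFinM.
by congr EFin; exact: mulrC.
Qed.

Lemma relent_seq_infty n : ~ acL (box d n) -> relent_seq mu nu n = +oo%E.
Proof.
move=> /existsNP[z /not_implyP[qz /eqP pz]].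
rewrite /relent_seq; under eq_bigr do rewrite !cylpE.
by rewrite (sum_relterm_infty pz qz) gt0_muley // lte_fin invr_gt0 vol_gt0.
Qed.

Variables (m M : nat) (c : R).
Hypothesis mM : (m <= M)%N.
Hypothesis dec : forall A B : set (cfg d T),
  <<s @coordsets d T [set x | x \in box d m] >> A ->
  <<s @coordsets d T [set x | x \notin box d M] >> B ->
  fine (nu A) * fine (nu B) != 0 ->
  fine (nu (A `&` B)) / (fine (nu A) * fine (nu B)) <= expR c.

Lemma klL_decoupled L : (forall y, y \in L -> y \notin box d M) ->
  acL (box d m `|` L)%fset ->
  klL (box d m) + klL L - c <= klL (box d m `|` L)%fset.
Proof.
move=> LM ac; set B := box d m.
pose pBL (w : cfgm d T) := (rst B w, rst L w).
pose h (z : {ffun (B `|` L)%fset -> T}) : {ffun B -> T} * {ffun L -> T} :=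
  (trunc B 0 z, trunc L 0 z).
have mBL : fmeas pBL by apply: fmeas_pair; exact: fmeas_rst.
have hE w : pBL w = h (rst (B `|` L)%fset w).
  have s0 : shift 0 w = w by apply/funext => y; rewrite /Defs.shift add0r.
  by rewrite /pBL /h; congr (_, _); rewrite -[in LHS]s0; apply: rst_shift => y yL;
    rewrite addr0 inE yL ?orbT.
have e1 (la : probability (cfgm d T) R) : pr la pBL =1 push h (pr la (rst (B `|` L)%fset)).
  move=> z; rewrite -pr_comp; last exact: fmeas_rst.
  by congr (pr la _ z); apply/funext.
have eB (la : probability (cfgm d T) R) : pr la (rst B) =1 push fst (pr la pBL).
  by move=> z; rewrite -pr_comp.
have eL (la : probability (cfgm d T) R) : pr la (rst L) =1 push snd (pr la pBL).
  by move=> z; rewrite -pr_comp.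
apply: (@le_trans _ _ (kl (pr mu pBL) (pr nu pBL))); last first.
  by rewrite (eq_kl (e1 mu) (e1 nu)); apply: kl_push => // u; exact: pr_ge0.
rewrite /klL (eq_kl (eB mu) (eB nu)) (eq_kl (eL mu) (eL nu)).
apply: kl_pair => [u||u|u|[a b]]; try exact: pr_ge0.
- exact: pr_sum1.
- by rewrite !e1; apply: abscont_push => // v; exact: pr_ge0.
rewrite /= -eB -eL.
have -> : pr nu pBL (a, b) = fine (nu (cyl a `&` cyl b)).
  congr (fine (nu _)); rewrite !cyl_preimage.
  by apply/seteqP; split=> [w [/= -> ->]|w [/= ea eb]] //; rewrite /pBL /= ea eb.
rewrite -!cylpE /cylp.
have mA : measurable (cyl a : set (cfgm d T)) by exact: cyl_sigma.
have mB : measurable (cyl b : set (cfgm d T)) by exact: cyl_sigma.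
have mAB : measurable (cyl a `&` cyl b : set (cfgm d T)) by exact: measurableI.
have le1 : fine (nu (cyl a `&` cyl b)) <= fine (nu (cyl a)).
  by rewrite fine_le ?fin_num_measure // le_measure ?inE //; exact: subIsetl.
have le2 : fine (nu (cyl a `&` cyl b)) <= fine (nu (cyl b)).
  by rewrite fine_le ?fin_num_measure // le_measure ?inE //; exact: subIsetr.
(* Decoupling says nothing when a marginal vanishes, but then the joint cylinder is null by
   monotonicity. *)
have [q0|q0] := eqVneq (fine (nu (cyl a)) * fine (nu (cyl b))) 0.
  rewrite q0 mulr0; move/eqP: q0; rewrite mulf_eq0 => /orP[]/eqP <- //.
rewrite -ler_pdivrMr; last by rewrite lt_def q0 mulr_ge0 // fine_ge0.
apply: dec => //; apply: cyl_sigma => //.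
Qed.

(** One tile is peeled off at a time. Translating its centre to the origin puts the other tiles
    outside [box d M], where the decoupling hypothesis [dec] applies. *)
Lemma klL_tiles (U : seq (site d)) : (forall L, acL L) -> uniq U ->
  (size U)%:R * (klL (box d m) - c) <= klL (tiles m M U).
Proof.
move=> ac; elim: U => [_|u U IH /= /andP[uU Uu]].
  by rewrite mul0r; exact: klL_ge0.
set x := u *+ M.*2.+1; set L := fshift (tiles m M U) (- x).
have LM y : y \in L -> y \notin box d M.
  by rewrite in_fshift opprK => /(tiles_far mM uU); rewrite addrK.
rewrite -natr1 mulrDl mul1r.
apply: (@le_trans _ _ (klL (box d m `|` L)%fset)); last first.
  apply: (@klL_mono _ _ x) => // y; rewrite tiles_cons !inE !in_fshift opprK addrK.
  by [].
apply: le_trans (klL_decoupled LM (ac _)).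
have : klL (tiles m M U) <= klL L.
  by apply: (@klL_mono _ _ (- x)) => // y; rewrite in_fshift opprK subrK.
have := IH Uu; lra.
Qed.

Lemma klL_box_near (e : R) : (forall L, acL L) -> 0 < e -> \forall n \near \oo,
  (klL (box d m) - c) / vol M - e <= klL (box d n) / vol n.
Proof.
move=> ac e0; set v := _ / vol M.
(* For [v <= 0] nonnegativity of relative entropy suffices; the comparison of volumes below is
   multiplied by [v] and needs [v > 0]. *)
have [v0|v0] := leP v 0.
  apply: nearW => n; apply: (@le_trans _ _ 0); first lra.
  by rewrite divr_ge0 // klL_ge0.
have e'0 : 0 < e / (v + 1) by rewrite divr_gt0 // ltr_wpDl // ltW.
apply: filterS (near_tile d M e'0) => n [k [/andP[kn _] hn]].
set nk := (M + M.*2.+1 * k)%N in kn hn.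
have h1 : vol nk * v <= klL (box d n).
  have -> : vol nk * v = vol k * (klL (box d m) - c).
    by rewrite /nk boxcard_mul natrM -mulrA [X in _ * X]mulrC divfK ?vol_neq0.
  apply: le_trans (klL_tiles ac (fset_uniq _)) _.
  apply: (@klL_mono _ _ 0) => // y yt; rewrite addr0.
  by apply: (fsubsetP (sub_box d kn)); exact: (fsubsetP (tiles_box_sub d k mM)).
rewrite ler_pdivlMr ?vol_gt0 //; apply: le_trans h1.
have h2 : e / (v + 1) * v <= e.
  by rewrite mulrAC ler_pdivrMr ?ltr_wpDl ?(ltW v0) // ler_wpM2l ?(ltW e0) // lerDl.
have h3 : vol nk <= vol n by exact: vol_le.
have := ler_wpM2r (ltW v0) hn.
have := ler_wpM2r (ltW (vol_gt0 d R nk)) h2; have := ler_wpM2l (ltW e0) h3.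
move: (e / (v + 1)) (vol nk) (vol n) => e' a b; nra.
Qed.

End RelativeEntropyLimit.

(** Failure of absolute continuity on one box persists on all larger ones, so the sequence is then
    eventually [+oo]. Otherwise all block relative entropies are real and the Fekete criterion
    applies. *)
Lemma relent_cvg (R : realType) d (T : FinPointed.type) (mu nu : probability (cfgm d T) R) :
  trans_inv_meas mu -> asympt_decoupled nu ->
  exists a : \bar R, relent_seq mu nu n @[n --> \oo] --> a.
Proof.
move=> mu_inv [nu_inv [g [c [c0 [g0 dec]]]]].
have [ac|/existsNP[n0 nac]] := pselect (forall n, acL mu nu (box d n)); last first.
  exists +oo%E; apply: cvg_near_cst.
  exists n0 => // n /= n0n; apply: relent_seq_infty => ac; apply: nac.
  apply: (@acL_mono _ _ _ _ _ mu_inv nu_inv (box d n) (box d n0) 0) => // y.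
  by rewrite addr0; exact: (fsubsetP (sub_box d n0n)).
have acA L : acL mu nu L.
  have [n Ln] : exists n, forall y, y \in L -> y \in box d n.
    exists (\max_(y <- L) \max_(i < d) `|y ord0 i|%N) => y yL; apply/boxP => i.
    apply: leq_trans (leq_bigmax_seq _ yL isT).
    exact: (@leq_bigmax _ (fun i => `|y ord0 i|%N)).
  by apply: (@acL_mono _ _ _ _ _ mu_inv nu_inv (box d n) L 0) => // y /Ln; rewrite addr0.
pose vol n : R := (boxcard d n)%:R.
suff [a ha] : exists a : \bar R, (klL mu nu (box d n) / vol n)%:E @[n --> \oo] --> a.
  exists a; apply: cvg_trans ha; apply: near_eq_cvg.
  by apply: nearW => n; rewrite relent_seqE.
(* A tile of radius [m] occupies a cell of radius [m + g m], hence the denominator of the lower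
   estimate. The factor tends to 1 since [g m / m] vanishes, the remainder to 0 since [c m] is of
   smaller order than the volume. *)
apply: (@fekete_sup _ _ (fun m => (klL mu nu (box d m) - c m) / vol (m + g m)%N)
  (fun m => vol (m + g m)%N / vol m) (fun m => c m / vol m)).
- move=> m e e0; apply: klL_box_near => //; first exact: leq_addr.
  by move=> A B hA hB hAB; have /andP[_] := dec m A B hA hB hAB.
- move=> m; rewrite -/(vol m).
  have -> : vol (m + g m)%N / vol m * ((klL mu nu (box d m) - c m) / vol (m + g m)%N)
      + c m / vol m = klL mu nu (box d m) / vol m.
    by field; rewrite !vol_neq0.
  by [].
- by move=> m; rewrite divr_ge0.
- apply/cvgrPdist_le => e e0; apply: filterS (box_grow d e0 g0) => n h.
  rewrite distrC ger0_norm; last first.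
    by rewrite subr_ge0 ler_pdivlMr ?vol_gt0 // mul1r vol_le // leq_addr.
  by rewrite lerBlDl ler_pdivrMr ?vol_gt0.
- exact: c0.
Qed.

(** * Free boundary energies and partition functions *)

Lemma sum_expR_gt0 (R : realType) (I : finType) (a : I -> R) (i0 : I) :
  0 < \sum_i expR (- a i).
Proof.
rewrite (bigD1 i0) //=; apply: ltr_pwDl; first exact: expR_gt0.
by apply: sumr_ge0 => i _; exact: expR_ge0.
Qed.

(** The logarithm of a sum of exponentials is 1-Lipschitz for the supremum norm. The index [i0] only
    witnesses that the sum is not empty. *)
Lemma lnsum_dist (R : realType) (I : finType) (a b : I -> R) (e : R) (i0 : I) :
  (forall i, `|a i - b i| <= e) ->
  `|ln (\sum_i expR (- a i)) - ln (\sum_i expR (- b i))| <= e.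
Proof.
move=> ab.
have half (f g : I -> R) : (forall i, `|f i - g i| <= e) ->
    ln (\sum_i expR (- f i)) <= e + ln (\sum_i expR (- g i)).
  move=> fg; have f0 := sum_expR_gt0 f i0; have g0 := sum_expR_gt0 g i0.
  rewrite -[X in X + _]expRK -lnM ?posrE ?expR_gt0 // ler_ln ?posrE ?mulr_gt0 ?expR_gt0 //.
  rewrite mulr_sumr; apply: ler_sum => i _; rewrite -expRD ler_expR.
  by have := fg i; rewrite ler_norml => /andP[? ?]; lra.
have h1 := half _ _ ab.
have h2 : ln (\sum_i expR (- b i)) <= e + ln (\sum_i expR (- a i)).
  by apply: half => i; rewrite distrC.
by rewrite ler_norml; apply/andP; split; lra.
Qed.

Section FreeEnergy.
Variables (R : realType) (d : nat) (E E' : FinPointed.type).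
Variable Phi : {fset site d} -> cfg d (E * E') -> R.
Variable r : nat.
Hypothesis Phi_local : pot_local Phi.
Hypothesis Phi_range : forall A, (r < diam A)%N -> forall w, Phi A w = 0.
Hypothesis Phi_inv : pot_trans_inv Phi.
Implicit Types (A B D L : {fset site d}) (w : cfg d (E * E')) (x y : site d).

Lemma diam_ge A x y i : x \in A -> y \in A -> (`|x ord0 i - y ord0 i| <= diam A)%N.
Proof.
move=> xA yA; apply: leq_trans (leq_bigmax_seq _ xA isT).
apply: leq_trans (leq_bigmax_seq _ yA isT).
exact: (@leq_bigmax _ (fun i => `|x ord0 i - y ord0 i|%N)).
Qed.

Lemma diam_sub A x : x \in A -> (diam A <= r)%N -> (A `<=` fshift (box d r) x)%fset.
Proof.
move=> xA Ar; apply/fsubsetP => y yA; rewrite in_fshift; apply/boxP => i.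
by rewrite siteB; apply: leq_trans Ar; exact: diam_ge.
Qed.

Lemma Phi_eq0 A x w : x \in A -> ~~ (A `<=` fshift (box d r) x)%fset -> Phi A w = 0.
Proof.
move=> xA h; apply: Phi_range; rewrite ltnNge; apply: contra h; exact: diam_sub.
Qed.

Lemma fshiftK A x : fshift (fshift A (- x)) x = A.
Proof. by apply/fsetP => y; rewrite !in_fshift opprK subrK. Qed.

(** Up to translation only subsets of [box d r] interact, and each sees finitely many patterns; [M]
    is the sum of all these absolute values. Nonemptiness provides the site that is moved to the
    origin. *)
Lemma Phi_bounded : exists M : R, 0 <= M /\
  forall A w, A != fset0 -> `|Phi A w| <= M.
Proof.
pose M : R := \sum_(A <- fpowerset (box d r)) \sum_(z : {ffun A -> (E * E')%type})
  `|Phi A (glue z (fun=> point))|.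
exists M; split; first by apply: sumr_ge0 => A _; exact: sumr_ge0.
move=> A w /fset0Pn[x xA].
have [Ar|Ar] := boolP (A `<=` fshift (box d r) x)%fset; last first.
  rewrite (Phi_eq0 _ xA Ar) normr0.
  by apply: sumr_ge0 => B _; exact: sumr_ge0.
rewrite -(fshiftK A x) Phi_inv; set B := fshift A (- x).
have Br : B \in fpowerset (box d r).
  rewrite fpowersetE; apply/fsubsetP => y; rewrite in_fshift opprK => yA.
  by have := fsubsetP Ar _ yA; rewrite in_fshift addrK.
set v := shift x w.
have -> : Phi B v = Phi B (glue (rst B v) (fun=> point)).
  by apply: Phi_local => y yB; rewrite glue_in.
rewrite /M (big_fsetD1 B) //= (bigD1 (rst B v)) //= -addrA lerDl addr_ge0 //.
  exact: sumr_ge0.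
by apply: sumr_ge0 => ? _; exact: sumr_ge0.
Qed.

(** Free-boundary energy. The empty set is left out because no Hamiltonian contains it. *)
Definition energy_in L w : R := \sum_(A <- fpowerset L | A != fset0) Phi A w.

(** Inner boundary: an interacting set that meets both [L] and its complement has all its sites in
    [L] on it. *)
Definition bd L : {fset site d} :=
  [fset x in L | ~~ (fshift (box d r) x `<=` L)%fset]%fset.

Lemma bd_box n : (r <= n)%N -> (#|` bd (box d n)| <= boxcard d n - boxcard d (n - r))%N.
Proof.
move=> rn; rewrite /boxcard -cardfsDS; last by apply: sub_box; rewrite leq_subr.
apply: fsubset_leq_card; apply/fsubsetP => x; rewrite !inE /= => /andP[xn h].
rewrite xn andbT; apply: contra h => xr; apply: fsubset_trans (fshift_box_sub r xr) _.
by rewrite subnKC.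
Qed.

Lemma bd_fshift L x : bd (fshift L x) = fshift (bd L) x.
Proof.
apply/fsetP => y; rewrite in_fshift !inE /= in_fshift; congr (_ && ~~ _).
apply/fsubsetP/fsubsetP => h z.
  rewrite in_fshift opprB addrA => zy; have := h (z + x).
  by rewrite !in_fshift addrK; apply.
rewrite in_fshift => zy; have := h (z - x); rewrite !in_fshift; apply.
by rewrite opprB addrA subrK.
Qed.

Lemma card_bd_fshift L x : #|` bd (fshift L x)| = #|` bd L|.
Proof. by rewrite bd_fshift card_fshift. Qed.

Lemma energy_in_local L w w' : (forall x, x \in L -> w x = w' x) -> energy_in L w = energy_in L w'.
Proof.
move=> ww; rewrite /energy_in big_seq_cond [RHS]big_seq_cond; apply: eq_bigr => A.
rewrite fpowersetE => /andP[/fsubsetP AL _]; apply: Phi_local => x /AL; exact: ww.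
Qed.

Lemma fpowerset_fshift L x : fpowerset (fshift L x) = [fset fshift A x | A in fpowerset L]%fset.
Proof.
apply/fsetP => A; rewrite fpowersetE; apply/fsubsetP/imfsetP => [h|[B /= + ->]].
  exists (fshift A (- x)); rewrite /= ?fshiftK // fpowersetE.
  by apply/fsubsetP => y; rewrite in_fshift opprK => /h; rewrite in_fshift addrK.
rewrite fpowersetE => /fsubsetP BL y; rewrite !in_fshift; exact: BL.
Qed.

Lemma fshift_inj x : injective (fun A => fshift A x).
Proof.
move=> A B /fsetP AB; apply/fsetP => y; have := AB (y + x).
by rewrite !in_fshift addrK.
Qed.

Lemma fshift_eq0 A x : (fshift A x == fset0) = (A == fset0).
Proof. by rewrite -!cardfs_eq0 card_fshift. Qed.

Lemma energy_in_fshift L x w : energy_in (fshift L x) w = energy_in L (shift x w).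
Proof.
rewrite /energy_in fpowerset_fshift big_mkcond [RHS]big_mkcond big_imfset /=; last first.
  by move=> A B _ _; exact: fshift_inj.
by apply: eq_bigr => A _; rewrite fshift_eq0 Phi_inv.
Qed.

Variable M : R.
Hypothesis M_ge0 : 0 <= M.
Hypothesis Phi_le : forall A w, A != fset0 -> `|Phi A w| <= M.

(** Bounds the total interaction through one site: [M] times the number of subsets of a box of
    radius [r]. *)
Definition energy_bound : R := M * (2 ^ boxcard d r)%:R.

Lemma energy_bound_ge0 : 0 <= energy_bound.
Proof. by rewrite mulr_ge0. Qed.

Lemma sum_sub_le (S : {fset {fset site d}}) x :
  \sum_(D <- S | (D `<=` fshift (box d r) x)%fset) M <= energy_bound.
Proof.
rewrite big_fset_condE /= big_const_seq count_predT iter_addr_0 -mulr_natr.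
rewrite /energy_bound ler_wpM2l // ler_nat /boxcard -(card_fshift (box d r) x) -card_fpowerset.
apply: fsubset_leq_card; apply/fsubsetP => D.
by rewrite !inE /= fpowersetE => /andP[].
Qed.

(* Only the terms that meet both sets survive, and each of these contains a site of
   [bd A]. *)
Lemma energy_in_union A B w : [disjoint A & B]%fset ->
  `|energy_in (A `|` B)%fset w - (energy_in A w + energy_in B w)| <= energy_bound * #|` bd A|%:R.
Proof.
move=> AB; set L := (A `|` B)%fset.
pose mixed D := [&& D != fset0, ~~ (D `<=` A)%fset & ~~ (D `<=` B)%fset].
have part S : (S `<=` L)%fset ->
    energy_in S w = \sum_(D <- fpowerset L | (D != fset0) && (D `<=` S)%fset) Phi D w.
  move=> SL; rewrite /energy_in big_fset_condE [RHS]big_fset_condE; apply: eq_fbig => // D.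
  rewrite !inE /= !fpowersetE; have [DS|] := boolP (D `<=` S)%fset.
    by rewrite (fsubset_trans DS SL) andbT.
  by rewrite !andbF.
have -> : energy_in L w - (energy_in A w + energy_in B w)
    = \sum_(D <- fpowerset L | mixed D) Phi D w.
  rewrite (part A) ?fsubsetUl // (part B) ?fsubsetUr // /energy_in.
  apply/eqP; rewrite subr_eq addrC; apply/eqP.
  rewrite big_mkcond [X in X + _ + _]big_mkcond [X in _ + X + _]big_mkcond
    [X in _ + X]big_mkcond /= -!big_split /=.
  apply: eq_bigr => D _; rewrite /mixed.
  have [D0|D0] := boolP (D == fset0); first by rewrite !addr0.
  have [DA|DA] := boolP (D `<=` A)%fset; have [DB|DB] := boolP (D `<=` B)%fset;
    rewrite /= ?addr0 ?add0r //.
  have /fset0Pn[x xD] := D0; move/fdisjointP: AB => /(_ x (fsubsetP DA _ xD)).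
  by rewrite (fsubsetP DB _ xD).
apply: le_trans (ler_norm_sum _ _ _) _.
apply: (@le_trans _ _ (\sum_(D <- fpowerset L) \sum_(x <- bd A)
    (if (D `<=` fshift (box d r) x)%fset then M else 0))).
  rewrite big_mkcond /= big_seq [leRHS]big_seq; apply: ler_sum => D.
  rewrite fpowersetE => DL.
  have pos x : 0 <= (if (D `<=` fshift (box d r) x)%fset then M else 0) by case: ifP.
  case: ifP => [/and3P[D0 DA DB]|_]; last exact: sumr_ge0.
  have [P0|P0] := eqVneq (Phi D w) 0; first by rewrite P0 normr0 sumr_ge0.
  have [y yD yA] : exists2 y, y \in D & y \notin A.
    by apply/fsubsetPn.
  have [z zD zB] : exists2 z, z \in D & z \notin B by apply/fsubsetPn.
  have zA : z \in A by have := fsubsetP DL _ zD; rewrite inE (negbTE zB) orbF.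
  have Dz : (D `<=` fshift (box d r) z)%fset.
    by apply: contraNT P0 => h; apply/eqP; exact: Phi_eq0 h.
  have zbd : z \in bd A.
    rewrite !inE /= zA /=; apply: contra yA => /fsubsetP; apply.
    exact: (fsubsetP Dz).
  rewrite (big_fsetD1 z) //= Dz; apply: le_trans (Phi_le _ D0) _.
  by rewrite lerDl sumr_ge0.
rewrite exchange_big /= [leRHS]mulrC.
apply: (@le_trans _ _ (\sum_(x <- bd A) energy_bound)).
  by apply: ler_sum => x _; rewrite -big_mkcond /=; exact: sum_sub_le.
by rewrite big_const_seq count_predT iter_addr_0 mulr_natl.
Qed.

(** The energy of each set is shared equally among its sites; this is where the weight [1 / |A|] of
    the final formula comes from. *)
Definition site_energy L x w : R :=
  \sum_(D <- fpowerset L | x \in D) #|` D|%:R^-1 * Phi D w.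

Definition site_energy0 w : R := site_energy (box d r) 0 w.

Lemma energy_in_site_energy L w : energy_in L w = \sum_(x <- L) site_energy L x w.
Proof.
rewrite /energy_in /site_energy (exchange_big_dep xpredT) //=.
rewrite [LHS]big_mkcond /= big_seq [RHS]big_seq; apply: eq_bigr => D.
rewrite fpowersetE => DL; rewrite [RHS]big_fset_condE /=.
have -> : [fset i in L | i \in D]%fset = D.
  apply/fsetP => x; rewrite !inE /=; apply/andP/idP => [[]//|xD].
  by split=> //; exact: (fsubsetP DL).
rewrite big_const_seq count_predT iter_addr_0.
have [->|D0] := eqVneq D fset0; first by rewrite cardfs0 mulr0n.
by rewrite -[RHS]mulr_natl mulrA mulfV ?mul1r // pnatr_eq0 cardfs_eq0.
Qed.

Lemma site_energy_cap L x w : site_energy L x w = site_energy (L `&` fshift (box d r) x)%fset x w.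
Proof.
rewrite /site_energy big_mkcond [RHS]big_mkcond /=; apply/esym/big_fset_incl.
  apply/fsubsetP => D; rewrite !fpowersetE => /fsubset_trans; apply.
  exact: fsubsetIl.
move=> D; rewrite !fpowersetE fsubsetI => DL; rewrite DL /= => h.
by case: ifP => // xD; rewrite (Phi_eq0 _ xD h) mulr0.
Qed.

Lemma site_energy_bound L x w : `|site_energy L x w| <= energy_bound.
Proof.
rewrite site_energy_cap; set S := (_ `&` _)%fset.
apply: le_trans (ler_norm_sum _ _ _) _.
apply: le_trans (sum_sub_le (fpowerset S) x).
rewrite big_mkcond [leRHS]big_mkcond /= big_seq [leRHS]big_seq; apply: ler_sum => D.
rewrite fpowersetE fsubsetI => /andP[_ ->]; case: ifP => // xD.
have D0 : D != fset0 by apply/fset0Pn; exists x.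
rewrite normrM ger0_norm ?invr_ge0 //; apply: le_trans (Phi_le w D0).
rewrite ler_piMl // invf_le1 ?ler1n ?ltr0n cardfs_gt0 //.
Qed.

Lemma energy_in_bound L w : `|energy_in L w| <= energy_bound * #|` L|%:R.
Proof.
rewrite energy_in_site_energy; apply: le_trans (ler_norm_sum _ _ _) _.
apply: (@le_trans _ _ (\sum_(x <- L) energy_bound)).
  by apply: ler_sum => x _; exact: site_energy_bound.
by rewrite big_const_seq count_predT iter_addr_0 mulr_natr.
Qed.

Lemma site_energy0_shift x w : site_energy0 (shift x w) = site_energy (fshift (box d r) x) x w.
Proof.
rewrite /site_energy0 /site_energy fpowerset_fshift big_mkcond
  [RHS]big_mkcond [RHS]big_imfset /=; last first.
  by move=> A B _ _; exact: fshift_inj.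
by apply: eq_bigr => D _; rewrite in_fshift subrr card_fshift Phi_inv.
Qed.

(** At a site off [bd L] no interacting set leaves [L], so its share of the energy of [L] is already
    the full one. Every other site contributes at most two shares. *)
Lemma energy_in_sites L w :
  `|energy_in L w - \sum_(x <- L) site_energy0 (shift x w)| <= 2 * energy_bound * #|` bd L|%:R.
Proof.
rewrite energy_in_site_energy -sumrB; apply: le_trans (ler_norm_sum _ _ _) _.
apply: (@le_trans _ _ (\sum_(x <- L) if x \in bd L then 2 * energy_bound else 0)).
  rewrite big_seq [leRHS]big_seq; apply: ler_sum => x xL; rewrite site_energy0_shift.
  case: ifPn => [_|].
    apply: le_trans (ler_normB _ _) _; rewrite mulr_natl mulr2n.
    by apply: lerD; exact: site_energy_bound.
  rewrite !inE /= xL /= negbK => h.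
  rewrite site_energy_cap (_ : (_ `&` _)%fset = fshift (box d r) x) ?subrr ?normr0 //.
  by apply/fsetIidPr.
rewrite -big_mkcond /= big_fset_condE /= big_const_seq count_predT iter_addr_0 mulr_natr.
rewrite (_ : [fset _ in _ | _]%fset = bd L) //.
by apply/fsetP => x; rewrite !inE /= andbA andbb.
Qed.

(** Interacting sets that meet [L] lie in [L'], and they are the nonempty subsets of [L'] except
    those avoiding [L]. The finitely supported sum becomes a difference of free energies. *)
Lemma hamiltonianE L L' w : (forall x, x \in L -> (fshift (box d r) x `<=` L')%fset) ->
  hamiltonian Phi L w = energy_in L' w - energy_in (L' `\` L)%fset w.
Proof.
move=> LL'.
have LsubL' : (L `<=` L')%fset.
  by apply/fsubsetP => x xL; apply: (fsubsetP (LL' x xL)); rewrite in_fshift subrr box0.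
have -> : hamiltonian Phi L w = \sum_(A <- fpowerset L' | (A `&` L)%fset != fset0) Phi A w.
  rewrite /hamiltonian fsbig_mkcond.
  rewrite -(fsbig_widen [set` fpowerset L']) //=; last first.
    move=> A [_ /= hA]; rewrite patchE; case: ifPn => // /set_mem /= /fset0Pn[x].
    rewrite inE => /andP[xA xL]; apply: Phi_eq0 xA _.
    apply: contra_notN hA => h; rewrite fpowersetE.
    exact: fsubset_trans h (LL' x xL).
  rewrite -fsbig_seq ?fset_uniq // [RHS]big_mkcond /=; apply: eq_bigr => A _.
  by rewrite patchE mem_setE.
apply/eqP; rewrite eq_sym subr_eq; apply/eqP.
have -> : energy_in (L' `\` L)%fset w
    = \sum_(D <- fpowerset L' | (D != fset0) && ((D `&` L)%fset == fset0)) Phi D w.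
  rewrite /energy_in big_fset_condE [RHS]big_fset_condE; apply: eq_fbig => // D.
  by rewrite !inE /= !fpowersetE fsubsetD -fsetI_eq0; case: (_ `<=` _)%fset => //=;
    rewrite andbC.
rewrite /energy_in big_mkcond [X in X + _]big_mkcond [X in _ + X]big_mkcond /= -big_split /=.
apply: eq_bigr => D _.
have [->|D0] := eqVneq D fset0; first by rewrite fset0I eqxx addr0.
by case: eqP; rewrite ?addr0 ?add0r.
Qed.

Definition nbhd L : {fset site d} := (\bigcup_(x <- L) fshift (box d r) x)%fset.

Lemma nbhd_sub L x : x \in L -> (fshift (box d r) x `<=` nbhd L)%fset.
Proof.
by move=> xL; apply/fsubsetP => y yx; apply/bigfcupP; exists x; rewrite ?xL.
Qed.

Lemma hamiltonian_energy_in L w :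
  `|hamiltonian Phi L w - energy_in L w| <= energy_bound * #|` bd L|%:R.
Proof.
have LN : (L `<=` nbhd L)%fset.
  by apply/fsubsetP => x xL; apply: (fsubsetP (nbhd_sub xL)); rewrite in_fshift subrr box0.
rewrite (@hamiltonianE _ (nbhd L)); last exact: nbhd_sub.
have := @energy_in_union L (nbhd L `\` L)%fset w; rewrite -fsubset_split // => h.
rewrite -addrA -opprD [X in _ - X]addrC; apply: h.
by apply/fdisjointP => x xA; rewrite inE xA.
Qed.

(** On the neighbourhood [N] of [L] the energy splits into those of [S] and of [N] without [S], up
    to a surface term. The second part does not see the change; one surface term for each of [w] and
    [w'] gives the factor 2. *)
Lemma hamiltonian_resample S L w w' : (S `<=` L)%fset ->
  (forall x, x \notin S -> w x = w' x) ->
  `|(hamiltonian Phi L w - hamiltonian Phi L w') - (energy_in S w - energy_in S w')|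
    <= 2 * energy_bound * #|` bd S|%:R.
Proof.
move=> SL ww; set N := nbhd L.
have LN : (L `<=` N)%fset.
  by apply/fsubsetP => x xL; apply: (fsubsetP (nbhd_sub xL)); rewrite in_fshift subrr box0.
have SN := fsubset_trans SL LN.
rewrite !(@hamiltonianE _ N); try exact: nbhd_sub.
have dS : [disjoint S & N `\` S]%fset by apply/fdisjointP => x xA; rewrite inE xA.
have := energy_in_union w dS; have := energy_in_union w' dS; rewrite -fsubset_split //.
have -> : energy_in (N `\` L)%fset w = energy_in (N `\` L)%fset w'.
  apply: energy_in_local => x; rewrite inE => /andP[xL _]; apply: ww.
  by apply: contra xL; exact: (fsubsetP SL).
have -> : energy_in (N `\` S)%fset w = energy_in (N `\` S)%fset w'.
  by apply: energy_in_local => x; rewrite inE => /andP[xS _]; exact: ww.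
rewrite !ler_norml => /andP[? ?] /andP[? ?]; apply/andP; split; lra.
Qed.

(** * Free partition functions *)

Section PartitionFunction.
Variable sb : cfg d E.

(** Free-boundary partition function: [sb] only completes the spin configuration at sites that
    [energy_in L] does not read. *)
Definition Zf L (eta : cfg d E') : R :=
  \sum_(s : {ffun L -> E}) expR (- energy_in L (pairc (glue s sb) eta)).

Definition Xf L (eta : cfg d E') : R := ln (Zf L eta).

Lemma Zf_gt0 L eta : 0 < Zf L eta.
Proof. by apply: sum_expR_gt0; exact: [ffun=> point]. Qed.

Lemma sum_ffun_union (F : cfg d E -> R) A B : [disjoint A & B]%fset ->
  \sum_(s : {ffun (A `|` B)%fset -> E}) F (glue s sb)
    = \sum_(ab : {ffun A -> E} * {ffun B -> E}) F (glue ab.1 (glue ab.2 sb)).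
Proof.
move=> AB.
pose f (ab : {ffun A -> E} * {ffun B -> E}) : {ffun (A `|` B)%fset -> E} :=
  rst _ (glue ab.1 (glue ab.2 sb)).
pose g (s : {ffun (A `|` B)%fset -> E}) := (rst A (glue s sb), rst B (glue s sb)).
have gf ab : glue (f ab) sb = glue ab.1 (glue ab.2 sb).
  apply/funext => x; have [xAB|xAB] := boolP (x \in (A `|` B)%fset).
    by rewrite glue_in.
  move: (xAB); rewrite inE negb_or => /andP[xA xB].
  by rewrite !glue_out.
rewrite (reindex f) /=; first by apply: eq_bigr => ab _; rewrite gf.
exists g => [[a b] _|s _].
  rewrite /g gf rst_glue; congr (_, _); apply/ffunP => -[x xB]; rewrite ffunE /=.
  rewrite glue_out ?(glueE _ _ xB) //.
  by apply: contraL xB => xA; move/fdisjointP : AB; apply.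
apply/ffunP => -[x xAB]; rewrite ffunE /= /g /=.
have [xA|xA] := boolP (x \in A); first by rewrite glue_in // (glueE _ _ xAB).
rewrite glue_out // glue_in ?(glueE _ _ xAB) //.
by move: (xAB); rewrite inE (negbTE xA).
Qed.

(** The product of the two partition functions is a sum over pairs of patterns, that is, over
    patterns on the union; the exponents are compared term by term. *)
Lemma Xf_union A B eta : [disjoint A & B]%fset ->
  `|Xf (A `|` B)%fset eta - (Xf A eta + Xf B eta)| <= energy_bound * #|` bd A|%:R.
Proof.
move=> AB; rewrite /Xf -lnM ?posrE ?Zf_gt0 //.
rewrite /Zf (sum_ffun_union (fun s => expR (- energy_in _ (pairc s eta)))) //.
rewrite big_distrlr /= pair_bigA /=.
have -> : \sum_(p : {ffun A -> E} * {ffun B -> E})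
      expR (- energy_in A (pairc (glue p.1 sb) eta))
        * expR (- energy_in B (pairc (glue p.2 sb) eta))
    = \sum_(p : {ffun A -> E} * {ffun B -> E})
      expR (- (energy_in A (pairc (glue p.1 sb) eta) + energy_in B (pairc (glue p.2 sb) eta))).
  by apply: eq_bigr => p _; rewrite opprD expRD.
apply: lnsum_dist; first exact: ([ffun=> point], [ffun=> point]).
move=> [a b] /=; set w := pairc (glue a (glue b sb)) eta.
have -> : energy_in A (pairc (glue a sb) eta) = energy_in A w.
  by apply: energy_in_local => x xA; rewrite /w /pairc !(glueE _ _ xA).
have -> : energy_in B (pairc (glue b sb) eta) = energy_in B w.
  apply: energy_in_local => x xB; rewrite /w /pairc [in RHS]glue_out ?(glueE _ _ xB) //.
  by apply: contraL xB => xA; move/fdisjointP : AB; apply.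
exact: energy_in_union.
Qed.

Lemma Zpart_Xf L eta : `|ln (Zpart Phi L sb eta) - Xf L eta| <= energy_bound * #|` bd L|%:R.
Proof.
apply: lnsum_dist => [|s]; first exact: [ffun=> point].
exact: hamiltonian_energy_in.
Qed.

Lemma Xf_bound L eta : `|Xf L eta| <= (energy_bound + ln #|E|%:R) * #|` L|%:R.
Proof.
have := @lnsum_dist _ {ffun L -> E} (fun s => energy_in L (pairc (glue s sb) eta))
  (fun=> 0) (energy_bound * #|` L|%:R) [ffun=> point].
rewrite -/(Zf L eta) -/(Xf L eta) oppr0 expR0 sumr_const card_ffun -cardfE natrX lnXn; last first.
  by rewrite ltr0n; apply/card_gt0P; exists point.
rewrite -[X in `|_ - X|]mulr_natr => h.
have l0 : 0 <= ln #|E|%:R * #|` L|%:R :> R.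
  by rewrite mulr_ge0 // ln_ge0 // ler1n; apply/card_gt0P; exists point.
rewrite -(subrK (ln #|E|%:R * #|` L|%:R) (Xf L eta)); apply: le_trans (ler_normD _ _) _.
rewrite [leRHS]mulrDl (ger0_norm l0) lerD2r; apply: h => s.
by rewrite addr0 energy_in_bound.
Qed.

Lemma Xf_local L eta eta' : (forall x, x \in L -> eta x = eta' x) -> Xf L eta = Xf L eta'.
Proof.
move=> h; congr ln; apply: eq_bigr => s _; congr (expR (- _)); apply: energy_in_local => x xL.
by rewrite /pairc h.
Qed.

(** A bijection of spin patterns. That [sb] is not translated does no harm, since the energy reads
    spins inside the volume only. *)
Lemma Xf_fshift L x eta : Xf (fshift L x) eta = Xf L (shift x eta).
Proof.
congr ln.
pose f (s : {ffun L -> E}) : {ffun fshift L x -> E} := rst _ (shift (- x) (glue s sb)).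
pose g (t : {ffun fshift L x -> E}) : {ffun L -> E} := rst _ (shift x (glue t sb)).
have xin y : y \in L -> x + y \in fshift L x by rewrite in_fshift addrC addKr.
rewrite /Zf (reindex f) /=.
  apply: eq_bigr => s _; rewrite energy_in_fshift; congr (expR (- _)).
  apply: energy_in_local => y yL.
  rewrite /Defs.shift /pairc /f glue_in ?xin //.
  by rewrite /Defs.shift addKr.
exists g => [s _|t _].
  apply/ffunP => -[y yL]; rewrite ffunE /= /Defs.shift /f glue_in ?xin //.
  by rewrite /Defs.shift addKr (glueE _ _ yL).
apply/ffunP => -[y yL]; rewrite ffunE /= /Defs.shift /g glue_in; last first.
  by move: yL; rewrite in_fshift addrC.
by rewrite /Defs.shift addNKr (glueE _ _ yL).
Qed.

(** * Resampling the spins of a subvolume *)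

Section Resample.
Variables (S L : {fset site d}) (eta : cfg d E').
Hypothesis SL : (S `<=` L)%fset.

Definition boltzmann (s : {ffun L -> E}) : R :=
  expR (- hamiltonian Phi L (pairc (glue s sb) eta)).

(** Unnormalised Gibbs weight, in the volume [L], of the event that the spins show [a] on [S]. *)
Definition cyl_weight (a : {ffun S -> E}) : R :=
  \sum_(s : {ffun L -> E} | rst S (glue s sb) == a) boltzmann s.

Definition spin_energy (a : {ffun S -> E}) : R := energy_in S (pairc (glue a sb) eta).

Definition boundary_err : R := 2 * energy_bound * #|` bd S|%:R.

Definition resample (a : {ffun S -> E}) (s : {ffun L -> E}) : {ffun L -> E} :=
  rst L (glue a (glue s sb)).

Lemma glue_resample a s : glue (resample a s) sb = glue a (glue s sb).
Proof.
apply/funext => x; have [xL|xL] := boolP (x \in L); first by rewrite glue_in.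
have xS : x \notin S by apply: contra xL; exact: (fsubsetP SL).
by rewrite !glue_out.
Qed.

Lemma resampleK a b s : rst S (glue s sb) = a -> resample a (resample b s) = s.
Proof.
move=> sa; apply/ffunP => -[x xL]; rewrite ffunE /= glue_resample.
have [xS|xS] := boolP (x \in S).
  by rewrite -sa glue_in // (glueE _ _ xL).
by rewrite glue_out // glue_out // (glueE _ _ xL).
Qed.

Lemma boltzmann_resample a b s : rst S (glue s sb) = b ->
  boltzmann (resample a s) * expR (spin_energy a)
    <= expR boundary_err * (boltzmann s * expR (spin_energy b)).
Proof.
move=> sb'; rewrite /boltzmann -!expRD ler_expR.
have := @hamiltonian_resample S L (pairc (glue (resample a s) sb) eta) (pairc (glue s sb) eta) SL.
have -> : energy_in S (pairc (glue (resample a s) sb) eta) = spin_energy a.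
  by apply: energy_in_local => x xS; rewrite /pairc glue_resample !(glueE _ _ xS).
have -> : energy_in S (pairc (glue s sb) eta) = spin_energy b.
  by apply: energy_in_local => x xS; rewrite /pairc -sb' glue_in.
rewrite -/boundary_err => h; have := h _; rewrite ler_norml => {}h.
have /andP[? ?] : - boundary_err <= hamiltonian Phi L (pairc (glue (resample a s) sb) eta)
    - hamiltonian Phi L (pairc (glue s sb) eta) - (spin_energy a - spin_energy b) <= boundary_err.
  by apply: h => x xS; rewrite /pairc glue_resample glue_out.
lra.
Qed.

(** Resampling is a bijection from the configurations showing [b] on [S] to those showing [a], and
    it changes each weight in a controlled way. *)
Lemma cyl_weight_le a b :
  cyl_weight a * expR (spin_energy a) <= expR boundary_err * (cyl_weight b * expR (spin_energy b)).
Proof.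
rewrite /cyl_weight (reindex_onto (resample a) (resample b)) /=; last first.
  by move=> s /eqP sa; exact: resampleK.
rewrite (eq_bigl (fun s => rst S (glue s sb) == b)); last first.
  move=> s; rewrite glue_resample rst_glue eqxx /=; apply/eqP/eqP => [<-|]; last exact: resampleK.
  by rewrite glue_resample rst_glue.
rewrite !mulr_suml mulr_sumr; apply: ler_sum => s /eqP sb'; exact: boltzmann_resample.
Qed.

Lemma Zpart_cyl_weight : Zpart Phi L sb eta = \sum_a cyl_weight a.
Proof. by rewrite /Zpart (partition_big (fun s => rst S (glue s sb)) xpredT). Qed.

(** By [cyl_weight_le], [cyl_weight a * expR (spin_energy a)] is independent of [a] up to the factor
    [expR boundary_err]. Summing this comparison over [b] against [expR (- spin_energy b)]
    identifies the common value with the quotient of [Zpart] by [Zf]. *)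
Lemma gibbs_ratio a :
  expR (- boundary_err) * (expR (- spin_energy a) / Zf S eta) <= cyl_weight a / Zpart Phi L sb eta
    <= expR boundary_err * (expR (- spin_energy a) / Zf S eta).
Proof.
have Z0 : 0 < Zpart Phi L sb eta by apply: sum_expR_gt0; exact: [ffun=> point].
have Zf0 := Zf_gt0 S eta.
have up : cyl_weight a * expR (spin_energy a) * Zf S eta <= expR boundary_err * Zpart Phi L sb eta.
  rewrite Zpart_cyl_weight /Zf !mulr_sumr; apply: ler_sum => b _.
  apply: le_trans (ler_wpM2r (expR_ge0 (- spin_energy b)) (cyl_weight_le a b)) _.
  by rewrite -mulrA -[X in _ * X <= _]mulrA -expRD subrr expR0 mulr1.
have dn : Zpart Phi L sb eta
    <= expR boundary_err * (cyl_weight a * expR (spin_energy a) * Zf S eta).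
  rewrite Zpart_cyl_weight /Zf !mulr_sumr; apply: ler_sum => b _.
  have := ler_wpM2r (expR_ge0 (- spin_energy b)) (cyl_weight_le b a).
  by rewrite -[leLHS]mulrA -expRD subrr expR0 mulr1 -[leRHS]mulrA.
have NE : cyl_weight a
    = cyl_weight a * expR (spin_energy a) * Zf S eta * (expR (- spin_energy a) / Zf S eta).
  by rewrite expRN; field; rewrite (gt_eqF Zf0) (gt_eqF (expR_gt0 _)).
have F0 : 0 <= expR (- spin_energy a) / Zf S eta by rewrite divr_ge0 ?expR_ge0 // ltW.
apply/andP; split.
  rewrite ler_pdivlMr // NE [leRHS]mulrC [leLHS]mulrAC.
  rewrite [leLHS]mulrC ler_wpM2l // expRN mulrC ler_pdivrMr ?expR_gt0 //.
  by rewrite mulrC.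
by rewrite ler_pdivrMr // {1}NE [leRHS]mulrAC ler_wpM2r.
Qed.

End Resample.

End PartitionFunction.

End FreeEnergy.

(** * Almost additive processes *)

Section BoundaryVolume.
Variables (R : realType) (d r : nat).
Local Notation vol n := ((boxcard d n)%:R : R).

Lemma bd_small (e : R) : 0 < e -> \forall n \near \oo,
  #|` bd r (box d n)|%:R <= e * vol n.
Proof.
move=> e0; have hs := @box_shrink d R r e e0; near=> n.
have rn : (r <= n)%N by near: n; exact: nbhs_infty_ge.
have : vol n <= (1 + e) * vol (n - r) by near: n.
have := bd_box d rn; rewrite -(ler_nat R) natrB ?leq_boxcard ?leq_subr //.
have := vol_le d R (leq_subr r n).
move: (vol n) (vol (n - r)%N) => a b; nra.
Unshelve. all: by end_near. Qed.

Lemma card_bd_le (L : {fset site d}) : (#|` bd r L| <= #|` L|)%N.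
Proof. by apply: fsubset_leq_card; apply/fsubsetP => x; rewrite !inE => /andP[]. Qed.

End BoundaryVolume.

Section AlmostAdditive.
Context {disp : measure_display} {T : measurableType disp} {R : realType}.
Variables (d r : nat) (mu : probability T R) (tau : site d -> T -> T).
Hypothesis tauD : forall x y w, tau x (tau y w) = tau (x + y) w.
Hypothesis tau_meas : forall x, measurable_fun [set: T] (tau x).
Hypothesis tau_inv : forall x B, measurable B -> mu (tau x @^-1` B) = mu B.
Variables (Y : {fset site d} -> T -> R) (C D : R).
Hypotheses (C_ge0 : 0 <= C) (D_ge0 : 0 <= D).
Hypothesis Y_union : forall A B w, [disjoint A & B]%fset ->
  `|Y (A `|` B)%fset w - (Y A w + Y B w)| <= C * #|` bd r A|%:R.
Hypothesis Y_bound : forall A w, `|Y A w| <= D * #|` A|%:R.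
Hypothesis Y_shift : forall A x w, Y (fshift A x) w = Y A (tau x w).
Hypothesis Y_meas : forall n, bmeas (Y (box d n)).
Local Notation vol n := ((boxcard d n)%:R : R).

(** Almost additivity is applied with the added piece first, because the boundary of that piece is
    at most its cardinality. *)
Lemma Y_sub A B w : (A `<=` B)%fset ->
  `|Y B w - Y A w| <= (C + D) * (#|` B|%:R - #|` A|%:R).
Proof.
move=> AB; have dAB : [disjoint B `\` A & A]%fset.
  by apply/fdisjointP => x; rewrite inE => /andP[].
have := Y_union w dAB; rewrite fsetUC -fsubset_split // => h.
have := Y_bound (B `\` A)%fset w; have := card_bd_le r (B `\` A)%fset.
rewrite -(ler_nat R) => /(ler_wpM2l C_ge0).
rewrite cardfsDS // natrB; last exact: fsubset_leq_card.
move: h; rewrite !ler_norml => /andP[? ?] ? /andP[? ?]; apply/andP; split; lra.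
Qed.

Lemma fshiftU A B (y : site d) :
  fshift (A `|` B)%fset y = (fshift A y `|` fshift B y)%fset.
Proof. by apply/fsetP => x; rewrite !inE !in_fshift inE. Qed.

Lemma fshift_disjoint A B (y : site d) : [disjoint A & B]%fset ->
  [disjoint fshift A y & fshift B y]%fset.
Proof. by move=> /fdisjointP h; apply/fdisjointP => x; rewrite !in_fshift; exact: h. Qed.

Lemma fshiftD A (x y : site d) : fshift (fshift A x) y = fshift A (x + y).
Proof. by apply/fsetP => z; rewrite !in_fshift opprD addrA addrAC. Qed.

Lemma Y_tiles m (U : seq (site d)) y w : uniq U ->
  `|Y (fshift (tiles m m U) y) w - \sum_(u <- U) Y (box d m) (tau (y + u *+ m.*2.+1) w)|
    <= (size U)%:R * (C * #|` bd r (box d m)|%:R).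
Proof.
elim: U => [_|u U IH /= /andP[uU Uu]].
  rewrite big_nil subr0 mul0r; apply: le_trans (Y_bound _ _) _.
  by rewrite card_fshift /tiles big_nil cardfs0 mulr0.
rewrite tiles_cons big_cons fshiftU.
have := Y_union w (fshift_disjoint y (tiles_disjoint (leqnn m) uU)).
have := IH Uu.
rewrite card_bd_fshift card_bd_fshift.
rewrite [fshift (tile m m u) y]fshiftD (Y_shift (box d m)) [u *+ _ + y]addrC.
rewrite -natr1 mulrDl mul1r.
by rewrite !ler_norml => /andP[? ?] /andP[? ?]; apply/andP; split; lra.
Qed.

(** For every offset [y] in [box d m] the translate of [box d n] by [y] is paved by [m]-boxes, and
    moving the box back costs only a shell. Averaging over all offsets turns the sparse sum over
    tile centres into the full ergodic average. *)
Lemma Y_avg m k n w : n = (m + m.*2.+1 * k)%N ->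
  `|Y (box d n) w / vol n - avg tau n (fun v => Y (box d m) v / vol m) w|
    <= C * #|` bd r (box d m)|%:R / vol m + 2 * (C + D) * ((vol (n + m) - vol n) / vol n).
Proof.
move=> nE; set b := #|` bd r (box d m)|%:R.
have one y : y \in box d m ->
    `|Y (box d n) w - \sum_(u <- box d k) Y (box d m) (tau (y + u *+ m.*2.+1) w)|
      <= vol k * (C * b) + 2 * (C + D) * (vol (n + m) - vol n).
  move=> ym; have := @Y_tiles m (box d k) y w (fset_uniq _); rewrite tiles_box -nE.
  have := Y_sub w (sub_box d (leq_addr m n)).
  have := Y_sub w (fshift_box_sub n ym); rewrite card_fshift -!/(boxcard d _).
  rewrite -/b !ler_norml => /andP[? ?] /andP[? ?] /andP[? ?]; apply/andP; split; lra.
have volE : vol n = vol k * vol m by rewrite nE boxcard_mul natrM.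
(* Every site of [box d n] is [y + u (2 m + 1)] for exactly one offset [y] and one index [u]. *)
have sumE : vol m * (vol n * (Y (box d n) w / vol n
      - avg tau n (fun v => Y (box d m) v / vol m) w))
    = \sum_(y <- box d m)
      (Y (box d n) w - \sum_(u <- box d k) Y (box d m) (tau (y + u *+ m.*2.+1) w)).
  rewrite sumrB sum_box_cst mulrBr mulrBr [vol n * (_ / _)]mulrC divfK ?vol_neq0 //.
  congr (_ - _); rewrite /avg [vol n * _]mulrA mulfV ?vol_neq0 // mul1r -mulr_suml.
  by rewrite mulrC divfK ?vol_neq0 // nE sum_box_tiles exchange_big.
have vm := vol_gt0 d R m; have vn := vol_gt0 d R n.
rewrite -(ler_pM2l vn) -(ler_pM2l vm) -[X in X * `|_|]ger0_norm ?(ltW vn) // -normrM.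
rewrite -[X in X * `|_|]ger0_norm ?(ltW vm) // -normrM sumE.
apply: le_trans (ler_norm_sum _ _ _) _.
apply: (@le_trans _ _ (\sum_(y <- box d m)
    (vol k * (C * b) + 2 * (C + D) * (vol (n + m) - vol n)))).
  by rewrite big_seq [leRHS]big_seq; apply: ler_sum.
rewrite sum_box_cst ler_pM2l // [leRHS]mulrDr; apply: lerD.
  by rewrite volE -[leRHS]mulrA ler_pM2l ?vol_gt0 // [leRHS]mulrC divfK ?vol_neq0.
by rewrite mulrCA [vol n * _]mulrC divfK ?vol_neq0.
Qed.

Lemma Y_near m (e : R) : 0 < e -> \forall n \near \oo, exists k,
  let nk := (m + m.*2.+1 * k)%N in (n <= nk + m.*2.+1)%N /\
  forall w, `|Y (box d n) w / vol n - Y (box d nk) w / vol nk| <= e.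
Proof.
(* [C + D] pays for the added shell, the other [D] for the change of normalisation, and 1 keeps [G]
   positive. *)
move=> e0; pose G := C + D + D + 1.
have G0 : 0 < G by rewrite ltr_wpDl // !addr_ge0.
have e'0 : 0 < e / G by rewrite divr_gt0.
apply: filterS (near_tile d m e'0) => n [k [/andP[kn nk'] hn]].
exists k; set nk := (m + m.*2.+1 * k)%N in kn nk' hn *; split=> // w.
have := Y_sub w (sub_box d kn); have := Y_bound (box d nk) w.
rewrite -!/(boxcard d _).
have vn := vol_gt0 d R n; have vk := vol_gt0 d R nk; have vkn := vol_le d R kn.
move: (Y (box d n) w) (Y (box d nk) w) => y1 y2 h1 h2.
have -> : y1 / vol n - y2 / vol nk = (y1 - y2) / vol n - y2 / vol nk * ((vol n - vol nk) / vol n).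
  by field; rewrite !vol_neq0.
have q : (vol n - vol nk) / vol n <= e / G.
  rewrite ler_pdivrMr // lerBlDl; apply: le_trans hn _.
  by rewrite mulrDl mul1r lerD2l ler_pM2l.
have q0 : 0 <= (vol n - vol nk) / vol n by rewrite divr_ge0 ?subr_ge0 // ltW.
apply: le_trans (ler_normB _ _) _.
have b1 : `|(y1 - y2) / vol n| <= (C + D) * (e / G).
  rewrite normrM [X in _ * X]ger0_norm ?invr_ge0 ?(ltW vn) //.
  apply: (@le_trans _ _ ((C + D) * ((vol n - vol nk) / vol n))).
    by rewrite mulrA ler_wpM2r // invr_ge0 ltW.
  by rewrite ler_wpM2l // addr_ge0.
have b2 : `|y2 / vol nk * ((vol n - vol nk) / vol n)| <= D * (e / G).
  rewrite normrM [X in _ * X]ger0_norm //; apply: ler_pM => //.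
  by rewrite normrM [X in _ * X]ger0_norm ?invr_ge0 ?(ltW vk) // ler_pdivrMr.
apply: le_trans (lerD b1 b2) _; rewrite -mulrDl mulrA ler_pdivrMr //.
by rewrite mulrC ler_pM2l // /G; lra.
Qed.

(** The exceptional set is the countable union over [m] of those of the ergodic theorem for [Y] on
    [box d m]. The limit [g] of these averages depends on the scale [m], hence on [e], and serves
    only as a common reference in a Cauchy estimate. *)
Lemma Y_cvg_ae : {ae mu, forall w, cvgn (fun n => Y (box d n) w / vol n)}.
Proof.
pose f m v := Y (box d m) v / vol m.
have bf m : bmeas (f m) by apply: bmeasM => //; exact: bmeas_cst.
have : {ae mu, forall w, forall m, cvgn (fun n => avg tau n (f m) w)}.
  apply/ae_foralln => m; exact: (ergodic_ae tauD tau_meas tau_inv (bf m)).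
apply: filterS => w hw; apply: cvgn_cauchy => e e0.
have e8 : 0 < e / 8 by rewrite divr_gt0.
have eC : 0 < e / 8 / (C + 1) by rewrite divr_gt0 // ltr_wpDl.
(* The scale [m] is fixed first, to make the boundary cost per site small; the remaining errors
   vanish as [n] grows with [m] fixed. *)
have [m _ /(_ m (leqnn m)) hm] := @bd_small R d r _ eC.
have {}hm : C * #|` bd r (box d m)|%:R / vol m <= e / 8.
  rewrite ler_pdivrMr ?vol_gt0 //; apply: le_trans (ler_wpM2l C_ge0 hm) _.
  rewrite mulrA ler_wpM2r // mulrCA ler_piMr ?(ltW e8) //.
  by rewrite ler_pdivrMr ?ltr_wpDl // mul1r lerDl.
have /cvg_ex[g /cvgrPdist_le /(_ _ e8)[N1 _ hN1]] := hw m.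
have eCD : 0 < e / 8 / (2 * (C + D) + 1).
  by rewrite divr_gt0 // ltr_wpDl // mulr_ge0 // addr_ge0.
have [N2 _ hN2] := @box_growC d R m _ eCD.
have [N3 _ hN3] := Y_near m e8.
suff hg n : (N1 + N2 + N3 + m.*2.+1 <= n)%N -> `|f n w - g| <= e / 2.
  exists (N1 + N2 + N3 + m.*2.+1)%N => n p Nn Np.
  have := hg n Nn; have := hg p Np; rewrite /f !ler_norml => /andP[? ?] /andP[? ?].
  by apply/andP; split; lra.
move=> Nn; have [|k [nk hk]] := hN3 n; first by rewrite /=; lia.
set nk' := (m + m.*2.+1 * k)%N in nk hk.
have := hk w; have := hN1 nk'; rewrite /= => h1; have {h1} := h1 ltac:(lia).
have h2 := Y_avg w (erefl nk'); rewrite -/(f m) in h2.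
have h3 : 2 * (C + D) * ((vol (nk' + m) - vol nk') / vol nk') <= e / 8.
  have := hN2 nk'; rewrite /= => h; have {}h := h ltac:(lia).
  apply: (@le_trans _ _ (2 * (C + D) * (e / 8 / (2 * (C + D) + 1)))).
    rewrite ler_wpM2l ?mulr_ge0 ?addr_ge0 // ler_pdivrMr ?vol_gt0 // lerBlDl.
    by rewrite -[X in X + _]mul1r -mulrDl.
  rewrite mulrCA ler_piMr ?(ltW e8) // ler_pdivrMr ?ltr_wpDl ?mulr_ge0 ?addr_ge0 //.
  by rewrite mul1r lerDl.
move: h2; rewrite /f !ler_norml => /andP[? ?] /andP[? ?] /andP[? ?]; apply/andP; split; lra.
Qed.

End AlmostAdditive.

(** * Cylinder probabilities of joint measures *)

Lemma EFin_Ex {disp : measure_display} {T : measurableType disp} {R : realType}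
    (mu : probability T R) (f : T -> R) : bmeas f ->
  (\int[mu]_w (f w)%:E)%E = (\int[mu]_w f w)%:E.
Proof. by move=> bf; rewrite fineK //; apply/integrable_fin_num => //; exact: bmeas_integrable. Qed.

Section JointBounds.
Variables (R : realType) (d : nat) (E E' : FinPointed.type).
Variable Phi : {fset site d} -> cfg d (E * E') -> R.
Variable r : nat.
Hypothesis Phi_local : pot_local Phi.
Hypothesis Phi_range : forall A, (r < diam A)%N -> forall w, Phi A w = 0.
Variable M : R.
Hypothesis M_ge0 : 0 <= M.
Hypothesis Phi_le : forall A w, A != fset0 -> `|Phi A w| <= M.
Variables (P : probability (cfgm d E') R) (sb : cfg d E).
Implicit Types (S L : {fset site d}).

Lemma bmeas_local (T : FinPointed.type) L (f : cfgm d T -> R) :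
  (forall w w', (forall x, x \in L -> w x = w' x) -> f w = f w') -> bmeas f.
Proof.
move=> h; pose G (z : {ffun L -> T}) := f (glue z (fun=> point)).
have -> : f = (fun w => G (rst L w)).
  by apply/funext => w; apply: h => x xL; rewrite glue_in.
exact: (bmeas_fin G (@fmeas_rst d T L)).
Qed.

Lemma nbhd_self L : (L `<=` nbhd r L)%fset.
Proof.
by apply/fsubsetP => x xL; apply: (fsubsetP (nbhd_sub r xL)); rewrite in_fshift subrr box0.
Qed.

Lemma hamiltonian_local L w w' : (forall x, x \in nbhd r L -> w x = w' x) ->
  hamiltonian Phi L w = hamiltonian Phi L w'.
Proof.
move=> h; rewrite !(hamiltonianE Phi_range _ (@nbhd_sub d r L)); congr (_ - _).
  exact: energy_in_local.
by apply: energy_in_local => // x; rewrite inE => /andP[_]; exact: h.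
Qed.

Lemma Zpart_local L eta eta' : (forall x, x \in nbhd r L -> eta x = eta' x) ->
  Zpart Phi L sb eta = Zpart Phi L sb eta'.
Proof.
move=> h; apply: eq_bigr => s _; congr (expR (- _)); apply: hamiltonian_local => x xN.
by rewrite /pairc h.
Qed.

Definition ffst S (z : {ffun S -> (E * E')%type}) : {ffun S -> E} := [ffun x => (z x).1].
Definition fsnd S (z : {ffun S -> (E * E')%type}) : {ffun S -> E'} := [ffun x => (z x).2].

(** Free-boundary Gibbs probability of the spin part of [z] given its disorder part. The default
    [point] fills sites that are not read. *)
Definition free_gibbs S (z : {ffun S -> (E * E')%type}) : R :=
  expR (- energy_in Phi S (pairc (glue (ffst z) sb) (glue (fsnd z) (fun=> point))))
    / Zf Phi sb S (glue (fsnd z) (fun=> point)).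

Lemma free_gibbs_gt0 S (z : {ffun S -> (E * E')%type}) : 0 < free_gibbs z.
Proof. by rewrite divr_gt0 ?expR_gt0 ?Zf_gt0. Qed.

Lemma ln_free_gibbs S (z : {ffun S -> (E * E')%type}) :
  ln (free_gibbs z) = - energy_in Phi S (glue z (fun=> point))
    - Xf Phi sb S (glue (fsnd z) (fun=> point)).
Proof.
rewrite ln_div ?posrE ?expR_gt0 ?Zf_gt0 // expRK; congr (- _ - _).
apply: energy_in_local => // x xS; rewrite /pairc !(glueE _ _ xS) !ffunE.
by case: (z _).
Qed.

(** The integrand of [Qint] at the indicator of a cylinder, written so that the two agree by
    conversion. *)
Definition gibbs_cyl S L (z : {ffun S -> (E * E')%type}) (eta : cfg d E') : R :=
  \sum_(s : {ffun L -> E})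
        (expR (- hamiltonian Phi L (pairc (glue s sb) eta))
           / Zpart Phi L sb eta) * \1_(cyl z) (pairc (glue s sb) eta).

Lemma gibbs_cylE S L (z : {ffun S -> (E * E')%type}) eta :
  gibbs_cyl L z eta
    = cyl_weight Phi sb L eta (ffst z) / Zpart Phi L sb eta * \1_(cyl (fsnd z)) eta.
Proof.
rewrite /gibbs_cyl; have [he|he] := pselect (cyl (fsnd z) eta); last first.
  rewrite [\1_(cyl (fsnd z)) eta]indicE memNset // mulr0 big1 // => s _.
  rewrite indicE memNset ?mulr0 // => hz; apply: he => x.
  by have := hz x; rewrite /pairc ffunE => <-.
rewrite [\1_(cyl (fsnd z)) eta]indicE mem_set // mulr1 /cyl_weight mulr_suml [RHS]big_mkcond /=.
apply: eq_bigr => s _; rewrite indicE -/(boltzmann Phi sb eta s).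
have -> : (pairc (glue s sb) eta \in cyl z) = (rst S (glue s sb) == ffst z).
  apply/idP/eqP => [/set_mem hz|hs].
    by apply/ffunP => x; have := hz x; rewrite /pairc !ffunE => <-.
  apply/mem_set => x; have := he x; rewrite /pairc ffunE => ->.
  have : rst S (glue s sb) x = ffst z x by rewrite hs.
  by rewrite !ffunE => ->; case: (z x).
by case: (_ == _); rewrite ?mulr1 ?mulr0.
Qed.

Lemma gibbs_cyl_bounds S L (z : {ffun S -> (E * E')%type}) eta : (S `<=` L)%fset ->
  expR (- boundary_err r M S) * free_gibbs z * \1_(cyl (fsnd z)) eta <= gibbs_cyl L z eta
    <= expR (boundary_err r M S) * free_gibbs z * \1_(cyl (fsnd z)) eta.
Proof.
move=> SL; rewrite gibbs_cylE.
have [he|he] := pselect (cyl (fsnd z) eta); last first.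
  by rewrite indicE memNset // !mulr0 lexx.
rewrite indicE mem_set // !mulr1.
have agree x : x \in S -> eta x = glue (fsnd z) (fun=> point) x.
  by move=> xS; rewrite (glueE _ _ xS); exact: (he [` xS]%fset).
have -> : free_gibbs z = expR (- spin_energy Phi sb eta (ffst z)) / Zf Phi sb S eta.
  rewrite /free_gibbs; congr (expR (- _) / _); last first.
    apply: eq_bigr => s _; congr (expR (- _)); apply: energy_in_local => // x xS.
    by rewrite /pairc agree.
  by apply: energy_in_local => // x xS; rewrite /pairc agree.
exact: (gibbs_ratio Phi_local Phi_range M_ge0 Phi_le).
Qed.

Lemma bmeas_gibbs_cyl S L (z : {ffun S -> (E * E')%type}) : (S `<=` L)%fset ->
  bmeas (gibbs_cyl L z : cfgm d E' -> R).
Proof.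
move=> SL; apply: (@bmeas_local _ (nbhd r L)) => w w' ww.
have SN := fsubset_trans SL (nbhd_self L).
rewrite !gibbs_cylE; congr (_ / _ * _).
- apply: eq_bigr => s _; congr (expR (- _)); apply: hamiltonian_local => x xN.
  by rewrite /pairc ww.
- exact: Zpart_local.
have wwS (x : S) : w (val x) = w' (val x) by apply: ww; exact: (fsubsetP SN _ (valP x)).
rewrite !indicE; congr (nat_of_bool _)%:R.
by apply/idP/idP => /set_mem h; apply/mem_set => x; rewrite -(h x) wwS.
Qed.

Lemma Qint_bounds S L (z : {ffun S -> (E * E')%type}) : (S `<=` L)%fset ->
  ((expR (- boundary_err r M S) * free_gibbs z * cylp P (fsnd z))%:E
    <= Qint Phi P sb L (fun w => \1_(cyl z) w))%E /\
  (Qint Phi P sb L (fun w => \1_(cyl z) w)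
    <= (expR (boundary_err r M S) * free_gibbs z * cylp P (fsnd z))%:E)%E.
Proof.
move=> SL; rewrite /Qint -[X in (_ <= X)%E /\ _]/(\int[P]_eta (gibbs_cyl L z eta)%:E)%E.
rewrite -[X in _ /\ (X <= _)%E]/(\int[P]_eta (gibbs_cyl L z eta)%:E)%E.
have bi := bmeas_gibbs_cyl z SL.
rewrite (EFin_Ex P bi) !lee_fin.
have mC : measurable (cyl (fsnd z) : set (cfgm d E')) by exact: cyl_sigma.
have bI := @bmeas_indic _ _ R _ mC.
rewrite -[cylp P _](Ex_indic P mC) -!(ExZ P _ bI).
by split; apply: Ex_le => //; try exact: bmeasZ; move=> eta;
  have /andP[] := gibbs_cyl_bounds z eta SL.
Qed.

Variable Kb : probability (cfgm d (E * E')%type) R.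
Hypothesis Kb_joint : is_joint_measure Phi P sb Kb.

Lemma quasilocal_cyl (T : Type) S (z : {ffun S -> T}) :
  quasilocal (fun w : cfg d T => \1_(cyl z) w : R).
Proof.
move=> w e e0; exists S => w' ww; rewrite !indicE.
have -> : (w' \in cyl z) = (w \in cyl z).
  by apply/idP/idP => /set_mem h; apply/mem_set => x; rewrite -h ww //; exact: valP.
by rewrite subrr normr0.
Qed.

(** The bounds in volume [L] depend on [S] only, as soon as [L] contains [S]. Cylinder indicators
    are quasilocal, so the bounds pass to the weak limit. *)
Lemma Kb_bounds S (z : {ffun S -> (E * E')%type}) :
  expR (- boundary_err r M S) * free_gibbs z * cylp P (fsnd z) <= cylp Kb z
    <= expR (boundary_err r M S) * free_gibbs z * cylp P (fsnd z).
Proof.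
have [Ls [Lmono [Lcov Lcvg]]] := Kb_joint.
have Lm N k : (Ls N `<=` Ls (N + k)%N)%fset.
  elim: k => [|k IH]; first by rewrite addn0.
  by rewrite addnS; exact: fsubset_trans IH (Lmono _).
have [N0 hN0] : exists N0, (S `<=` Ls N0)%fset.
  have /choice[nu nuP] := Lcov.
  exists (\max_(x <- S) nu x)%N; apply/fsubsetP => x xS.
  have le : (nu x <= \max_(x <- S) nu x)%N by exact: (@leq_bigmax_seq _ _ _ (fun x => nu x)).
  by rewrite -(subnKC le); apply: (fsubsetP (Lm _ _)).
have cv := Lcvg _ (quasilocal_cyl z).
have mC : measurable (cyl z : set (cfgm d (E * E')%type)) by exact: cyl_sigma.
have e1 : (\int[Kb]_w (\1_(cyl z) w)%:E)%E = (cylp Kb z)%:E.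
  by rewrite (EFin_Ex Kb (bmeas_indic mC)) Ex_indic.
rewrite e1 in cv.
apply/andP; split; rewrite -lee_fin.
  apply: cvge_ge cv; exists N0 => // N /= NN.
  by apply: (Qint_bounds z _).1; rewrite -(subnKC NN); exact: fsubset_trans (Lm _ _).
apply: cvge_le cv; exists N0 => // N /= NN.
by apply: (Qint_bounds z _).2; rewrite -(subnKC NN); exact: fsubset_trans (Lm _ _).
Qed.

End JointBounds.

(** * The Gibbs formula *)

Lemma cvg_dist (R : realType) (u v err : nat -> R) (l : R) :
  (forall n, `|v n - u n| <= err n) -> err @ \oo --> (0 : R) ->
  u @ \oo --> l -> v @ \oo --> l.
Proof.
move=> vu err0 ul; apply/cvgrPdist_le => e e0.
have e20 : 0 < e / 2 by rewrite divr_gt0.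
have h1 : \forall n \near \oo, `|l - u n| <= e / 2 by move/cvgrPdist_le : ul; exact.
have h2 : \forall n \near \oo, err n <= e / 2 by move/cvgr_le : err0; exact.
near=> n.
have : `|l - u n| <= e / 2 by near: n.
have : err n <= e / 2 by near: n.
have := vu n; rewrite !ler_norml => /andP[? ?] ? /andP[? ?].
by apply/andP; split; lra.
Unshelve. all: by end_near. Qed.

Lemma bd_vol_cvg (R : realType) (d r : nat) (c : R) : 0 <= c ->
  (fun n => c * #|` bd r (box d n)|%:R / (boxcard d n)%:R) @ \oo --> (0 : R).
Proof.
move=> c0; apply/cvgrPdist_le => e e0.
have e'0 : 0 < e / (c + 1) by rewrite divr_gt0 // ltr_wpDl.
apply: filterS (@bd_small R d r _ e'0) => n h.
rewrite sub0r normrN ger0_norm; last by rewrite divr_ge0 // mulr_ge0.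
rewrite ler_pdivrMr ?vol_gt0 //; apply: le_trans (ler_wpM2l c0 h) _.
rewrite mulrA ler_wpM2r // mulrCA ler_piMr ?(ltW e0) //.
by rewrite ler_pdivrMr ?ltr_wpDl // mul1r lerDl.
Qed.

Lemma Ex_dist {disp : measure_display} {T : measurableType disp} {R : realType}
    (mu : probability T R) (f g : T -> R) (c : R) : bmeas f -> bmeas g ->
  (forall w, `|f w - g w| <= c) -> `|\int[mu]_w f w - \int[mu]_w g w| <= c.
Proof.
move=> bf bg fg; rewrite -ExB // ler_norml.
have bfg := bmeasB bf bg; have bc := @bmeas_cst _ T R.
have h w : - c <= f w - g w <= c by rewrite -ler_norml.
rewrite -{1}(Ex_cst mu (- c)) -[X in _ && (_ <= X)](Ex_cst mu c).
by apply/andP; split; apply: Ex_le => // w; have /andP[] := h w.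
Qed.

(** If [q] were exactly [F] times [qd] composed with [g], the bracket would be an identity obtained
    by splitting [ln q]. The factor [expR c] moves [ln q] by at most [c] at each point, and
    positivity of [F] makes the null sets of [q] and [qd] correspond. *)
Lemma kl_product_bounds (R : realType) (U V : finType) (g : U -> V)
    (p q F : U -> R) (qd : V -> R) (c : R) :
  (forall u, 0 <= p u) -> \sum_u p u = 1 -> (forall v, 0 <= qd v) -> (forall u, 0 < F u) ->
  (forall u, expR (- c) * F u * qd (g u) <= q u <= expR c * F u * qd (g u)) ->
  (abscont p q <-> abscont (push g p) qd) /\
  (abscont p q -> `|kl p q - (kl (push g p) qd - ent p + ent (push g p)
                    - \sum_u p u * ln (F u))| <= c).
Proof.
move=> p0 p1 qd0 F0 qb.
have q_eq0 u : q u = 0 <-> qd (g u) = 0.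
  split=> h; have := qb u; rewrite h; last by rewrite !mulr0 -eq_le => /eqP.
  move=> /andP[h1 _]; apply/eqP; rewrite eq_le qd0 andbT.
  by rewrite -(pmulr_rle0 _ (mulr_gt0 (expR_gt0 (- c)) (F0 u))).
have acE : abscont p q <-> abscont (push g p) qd.
  split=> ac.
    by move=> v qv; apply: big1 => u /eqP guv; apply: ac; apply/q_eq0; rewrite guv.
  by move=> u /q_eq0 /ac; exact: push_eq0.
split=> // ac.
have -> : kl (push g p) qd - ent p + ent (push g p) - \sum_u p u * ln (F u)
    = \sum_u p u * ln (p u) - \sum_u p u * (ln (F u) + ln (qd (g u))).
  rewrite /kl /ent.
  have -> : \sum_u push g p u * (ln (push g p u) - ln (qd u))
      = \sum_u p u * ln (push g p (g u)) - \sum_u p u * ln (qd (g u)).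
    by rewrite sum_push -sumrB; apply: eq_bigr => u _; rewrite mulrBr.
  have -> : \sum_u p u * (ln (F u) + ln (qd (g u)))
      = \sum_u p u * ln (F u) + \sum_u p u * ln (qd (g u)).
    by rewrite -big_split /=; apply: eq_bigr => u _; rewrite mulrDr.
  rewrite sum_push; ring.
have -> : kl p q = \sum_u p u * ln (p u) - \sum_u p u * ln (q u).
  by rewrite /kl -sumrB; apply: eq_bigr => u _; rewrite mulrBr.
rewrite opprB addrC addrA subrK -sumrB; apply: le_trans (ler_norm_sum _ _ _) _.
rewrite -[leRHS]mul1r -p1 mulr_suml; apply: ler_sum => u _; rewrite -mulrBr normrM ger0_norm //.
have [->|pu0] := eqVneq (p u) 0; first by rewrite !mul0r.
have qdu : 0 < qd (g u).
  rewrite lt_def qd0 andbT; apply: contra_neq pu0 => h; apply: ac; exact/q_eq0.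
have qu : 0 < q u.
  by have /andP[+ _] := qb u; apply: lt_le_trans; rewrite !mulr_gt0 ?expR_gt0.
rewrite ler_wpM2l //; have /andP[h1 h2] := qb u; rewrite -lnM ?posrE //.
have FQ : 0 < F u * qd (g u) by rewrite mulr_gt0.
rewrite -mulrA in h1; rewrite -mulrA in h2.
have : ln (expR (- c) * (F u * qd (g u))) <= ln (q u).
  by rewrite ler_ln ?posrE ?mulr_gt0 ?expR_gt0.
have : ln (q u) <= ln (expR c * (F u * qd (g u))).
  by rewrite ler_ln ?posrE ?mulr_gt0 ?expR_gt0.
rewrite !lnM ?posrE ?expR_gt0 // !expRK ler_norml => ? ?; apply/andP; split; lra.
Qed.

(** The set [D] of convergence is measurable by the Cauchy criterion with tolerances [1 / (k + 1)].
    Off [D] the value of [limn] is the default [point], so [limn] is everywhere the limit of the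
    sequence modified off [D]. *)
Lemma measurable_limn {disp : measure_display} {T : measurableType disp} {R : realType}
    (u : nat -> T -> R) : (forall n, measurable_fun [set: T] (u n)) ->
  measurable_fun [set: T] (fun w => limn (u ^~ w)).
Proof.
move=> mu_n.
pose D := \bigcap_k \bigcup_N \bigcap_(n in ~` `I_N) \bigcap_(p in ~` `I_N)
  [set w | `|u n w - u p w| <= k.+1%:R^-1].
have DP w : D w <-> cvgn (u ^~ w).
  split=> [Dw|].
    apply: cvgn_cauchy => e e0.
    have [k _ hk] : \forall k \near \oo, k.+1%:R^-1 <= e.
      by have /cvgr_le := @cvg_harmonic R; apply.
    have [N _ hN] := Dw k I; exists N => n p Nn Np.
    apply: le_trans (hk k (leqnn k)).
    by apply: (hN n _ p) => /=; apply/negP; rewrite -leqNgt.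
  move=> /cvg_ex[l /cvgrPdist_le ul] k _.
  have : (0 : R) < k.+1%:R^-1 by rewrite invr_gt0.
  move: (k.+1%:R^-1 : R) => t t0.
  have [|N _ hN] := ul (t / 2); first by rewrite divr_gt0.
  exists N => // n /= /negP; rewrite -leqNgt => Nn p /= /negP; rewrite -leqNgt => Np.
  have := hN n Nn; have := hN p Np; rewrite /= !ler_norml => /andP[? ?] /andP[? ?].
  by apply/andP; split; lra.
have mD : measurable D.
  apply: bigcapT_measurable => k; apply: bigcupT_measurable => N.
  apply: bigcap_measurableType => n _; apply: bigcap_measurableType => p _.
  have mf : measurable_fun [set: T] (fun w => `|u n w - u p w|).
    by apply: measurableT_comp => //; exact: measurable_funB.
  have -> : [set w | `|u n w - u p w| <= k.+1%:R^-1]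
      = (fun w => `|u n w - u p w|) @^-1` `]-oo, k.+1%:R^-1].
    by apply/seteqP; split=> w /=; rewrite in_itv.
  by rewrite -[X in measurable X]setTI; apply: mf => //; exact: measurable_itv.
apply: (@measurable_fun_cvg _ _ _ _ (fun n w => if w \in D then u n w else point)).
  move=> n; apply: measurable_fun_ifT => //; apply: (measurable_fun_bool true).
  rewrite setTI (_ : _ @^-1` _ = D) //.
  by apply/seteqP; split=> w /=; [move=> /set_mem|move=> /mem_set ->].
move=> w _; have [Dw|nDw] := boolP (w \in D).
  by apply/DP/set_mem.
rewrite dvgP; first exact: cvg_cst.
by move=> /DP /mem_set h; rewrite h in nDw.
Qed.

(** * The disorder marginal *)

Section DisorderMarginal.
Variables (R : realType) (d : nat) (E E' : FinPointed.type).

Definition disorder (w : cfgm d (E * E')%type) : cfgm d E' := fun x => (w x).2.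

Lemma disorder_measurable : measurable_fun [set: cfgm d (E * E')%type] disorder.
Proof.
apply: (@measurability _ _ _ (cfgm d E') setT disorder (@coordsets d E' setT)) => //.
move=> _ [C [x [a [_ ->]]] <-]; rewrite setTI.
pose g (p : {ffun [fset x]%fset -> (E * E')%type}) := (p [` fset11 x]%fset).2.
have -> : disorder @^-1` [set w | w x = a] = (g \o rst [fset x]%fset) @^-1` [set a].
  by apply/seteqP; split=> w /=; rewrite /g ffunE.
by apply: fmeas_comp; exact: fmeas_rst.
Qed.

HB.instance Definition _ := isMeasurableFun.Build _ _ _ _ disorder disorder_measurable.

Variable K : probability (cfgm d (E * E')%type) R.

(** Convertible to [marg2 K], but packaged as a probability so that the entropy lemmas apply. *)
Definition disorder_law : probability (cfgm d E') R := distribution K disorder.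

Lemma disorder_law_inv : trans_inv_meas K -> trans_inv_meas disorder_law.
Proof.
move=> Kinv x B mB; have mdB : measurable (disorder @^-1` B).
  by rewrite -[X in measurable X]setTI; exact: disorder_measurable.
exact: (Kinv x _ mdB).
Qed.

Lemma pr_disorder_law S : pr disorder_law (rst S) =1 push (@fsnd d E E' S) (pr K (rst S)).
Proof.
move=> e; rewrite -pr_comp; last exact: fmeas_rst.
rewrite /pr; congr (fine (K _)); apply/seteqP; split=> w /= <-;
  by apply/ffunP => x; rewrite !ffunE.
Qed.

End DisorderMarginal.

(** * The formula at finite volume and its limit *)

Section GibbsFormula.
Variables (R : realType) (d : nat) (E E' : FinPointed.type).
Variable Phi : {fset site d} -> cfg d (E * E') -> R.
Variable r : nat.
Hypothesis Phi_local : pot_local Phi.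
Hypothesis Phi_range : forall A, (r < diam A)%N -> forall w, Phi A w = 0.
Hypothesis Phi_inv : pot_trans_inv Phi.
Variable M : R.
Hypothesis M_ge0 : 0 <= M.
Hypothesis Phi_le : forall A w, A != fset0 -> `|Phi A w| <= M.
Variables (P : probability (cfgm d E') R) (sb : cfg d E).
Variables Kb K : probability (cfgm d (E * E')%type) R.
Hypothesis Kb_joint : is_joint_measure Phi P sb Kb.
Hypothesis K_inv : trans_inv_meas K.
Local Notation vol n := ((boxcard d n)%:R : R).
Local Notation Ex f := (\int[K]_w f w).
Local Notation C := (energy_bound d r M).

Let C_ge0 : 0 <= C. Proof. exact: energy_bound_ge0. Qed.

Definition log_Z_free (L : {fset site d}) (w : cfgm d (E * E')%type) : R :=
  Xf Phi sb L (disorder w).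

Definition logZn (n : nat) (w : cfgm d (E * E')%type) : R :=
  (vol n)^-1 * ln (Zpart Phi (box d n) sb (disorder w)).

Lemma bmeas_energy_in L : bmeas (energy_in Phi L : cfgm d (E * E')%type -> R).
Proof. by apply: (@bmeas_local R d _ L); exact: energy_in_local. Qed.

Lemma bmeas_log_Z_free L : bmeas (log_Z_free L).
Proof.
apply: (@bmeas_local R d _ L) => w w' ww; apply: Xf_local => // x xL.
by rewrite /disorder ww.
Qed.

Lemma bmeas_Phi A : bmeas (Phi A : cfgm d (E * E')%type -> R).
Proof. by apply: (@bmeas_local R d _ A); exact: Phi_local. Qed.

Lemma bmeas_logZn n : bmeas (logZn n).
Proof.
apply: (@bmeas_local R d _ (nbhd r (box d n))) => w w' ww; congr (_ * ln _).
by apply: (Zpart_local Phi_local Phi_range) => x xN; rewrite /disorder ww.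
Qed.

(** The finite-volume formula. The correction [t] is existential and real, so one statement covers
    finite and infinite relative entropies. *)
Lemma relent_joint n : exists t : R,
  `|t - (- (entL K (box d n) / vol n) + entL (disorder_law K) (box d n) / vol n
       + (Ex (energy_in Phi (box d n)) / vol n + Ex (log_Z_free (box d n)) / vol n))|
     <= 2 * C * #|` bd r (box d n)|%:R / vol n /\
  relent_seq K Kb n = (relent_seq (disorder_law K) P n + t%:E)%E.
Proof.
set S := box d n.
pose t0 := - (entL K S / vol n) + entL (disorder_law K) S / vol n
  + (Ex (energy_in Phi S) / vol n + Ex (log_Z_free S) / vol n); rewrite -/t0.
pose p := pr K (rst S); pose q := pr Kb (rst S); pose qd := pr P (rst S).
have p0 z : 0 <= p z by exact: pr_ge0.
have p1 : \sum_z p z = 1 by apply: pr_sum1; exact: fmeas_rst.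
have qd0 z : 0 <= qd z by exact: pr_ge0.
have qb z : expR (- boundary_err r M S) * free_gibbs Phi sb z * qd (fsnd z) <= q z
    <= expR (boundary_err r M S) * free_gibbs Phi sb z * qd (fsnd z).
  have := Kb_bounds Phi_local Phi_range M_ge0 Phi_le Kb_joint z.
  by rewrite !cylpE.
have [acE klE] := @kl_product_bounds R _ _ (@fsnd d E E' S) p q (free_gibbs Phi sb (S := S)) qd _
  p0 p1 qd0 (@free_gibbs_gt0 R d E E' Phi sb S) qb.
have acE' : acL (disorder_law K) P S <-> abscont (push (@fsnd d E E' S) p) qd.
  by split=> h z; [rewrite -pr_disorder_law|rewrite pr_disorder_law]; exact: h.
have [ac|nac] := pselect (acL K Kb S); last first.
  (* Both relative entropies are [+oo] here, so any real would do in the equation; [t0] makes the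
     error zero. *)
  exists t0; split.
    by rewrite subrr normr0 divr_ge0 // !mulr_ge0.
  have nac' : ~ acL (disorder_law K) P S by move=> /acE'/acE.
  by rewrite (relent_seq_infty nac) (relent_seq_infty nac') addye.
exists ((klL K Kb S - klL (disorder_law K) P S) / vol n); split; last first.
  have ac' : acL (disorder_law K) P S by apply/acE'/acE.
  by rewrite (relent_seqE ac) (relent_seqE ac') -EFinD -mulrDl addrC subrK.
have {klE} := klE ac.
rewrite -/(klL K Kb S) -(eq_kl (@pr_disorder_law R d E E' K S) (frefl qd)).
rewrite -/(klL (disorder_law K) P S).
rewrite -(eq_ent (@pr_disorder_law R d E E' K S)) -/(entL K S) -/(entL (disorder_law K) S).
have -> : \sum_u p u * ln (free_gibbs Phi sb u) = - (Ex (energy_in Phi S) + Ex (log_Z_free S)).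
  rewrite -(@Ex_fin _ _ _ K _ (rst S) (fun z => ln (free_gibbs Phi sb z)) (@fmeas_rst d _ S)).
  have bH := bmeas_energy_in S; have bX := bmeas_log_Z_free S.
  rewrite -ExD // -mulN1r -ExZ; last exact: bmeasD.
  apply: eq_Rintegral => w _; rewrite ln_free_gibbs // mulN1r opprD; congr (- _ - _).
    by apply: energy_in_local => // x xS; rewrite glue_in.
  apply: Xf_local => // x xS; rewrite (glueE _ _ xS) !ffunE.
  by [].
rewrite [- - (_ + _)]opprK => h.
have -> : (klL K Kb S - klL (disorder_law K) P S) / vol n - t0
   = (klL K Kb S - (klL (disorder_law K) P S - entL K S + entL (disorder_law K) S
        + (Ex (energy_in Phi S) + Ex (log_Z_free S))))
      / vol n.
  by rewrite /t0; field; exact: vol_neq0.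
rewrite normrM [X in _ * X]ger0_norm; last by rewrite invr_ge0.
by apply: ler_wpM2r; [rewrite invr_ge0|exact: h].
Qed.

Lemma Ex_site_energy0 : Ex (site_energy0 Phi r) = \sum_(A \in [set A : {fset site d} | 0 \in A])
            ((#|` A|%:R)^-1 * fine (\int[K]_w (Phi A w)%:E)%E).
Proof.
have bP A : bmeas (fun w : cfgm d (E * E')%type => #|` A|%:R^-1 * Phi A w).
  by apply: bmeasZ; exact: bmeas_Phi.
rewrite /site_energy0 /site_energy Ex_sum // fsbig_mkcond.
rewrite -(fsbig_widen [set` fpowerset (box d r)]) //=; last first.
  move=> A [_ /= hA]; rewrite patchE; case: ifPn => // /set_mem /= A0.
  have P0 w : Phi A w = 0.
    apply: (Phi_eq0 Phi_range w A0); apply: contra_notN hA => h.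
    rewrite fpowersetE; apply: fsubset_trans h _; apply/fsubsetP => x.
    by rewrite in_fshift subr0.
  by under eq_integral do rewrite P0; rewrite integral0 mulr0.
rewrite -fsbig_seq ?fset_uniq // big_mkcond /=; apply: eq_bigr => A _.
rewrite patchE; have [A0|A0] := boolP (0 \in A); last by rewrite memNset //; exact/negP.
by rewrite mem_set //; exact: (ExZ K _ (bmeas_Phi A)).
Qed.

(** By invariance all translates of the site energy have the same mean, so only the boundary term
    depends on [n]. *)
Lemma Ex_energy_in_cvg :
  (fun n => Ex (energy_in Phi (box d n)) / vol n) @ \oo --> Ex (site_energy0 Phi r).
Proof.
have be : bmeas (site_energy0 Phi r : cfgm d (E * E')%type -> R).
  by apply: bmeas_sum => A; apply: bmeasZ; exact: bmeas_Phi.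
have bs x : bmeas (fun w : cfgm d (E * E')%type => site_energy0 Phi r (shift x w)).
  by apply: bmeas_comp be; exact: shift_measurable.
apply: (@cvg_dist _ (fun=> Ex (site_energy0 Phi r)) _
  (fun n => 2 * C * #|` bd r (box d n)|%:R / vol n)).
- move=> n.
  have -> : Ex (site_energy0 Phi r)
      = Ex (fun w => \sum_(x <- box d n) site_energy0 Phi r (shift x w)) / vol n.
    rewrite Ex_sum //; under eq_bigr => x _.
      rewrite (@Ex_comp _ _ _ K (shift x) (site_energy0 Phi r) (shift_measurable x) (K_inv x) be).
      over.
    by rewrite sum_box_cst mulrC mulKf // vol_neq0.
  rewrite -mulrBl normrM [X in _ * X]ger0_norm ?invr_ge0 // ler_wpM2r ?invr_ge0 //.
  apply: Ex_dist; [exact: bmeas_energy_in|exact: bmeas_sum|move=> w].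
  exact: (energy_in_sites Phi_range Phi_inv M_ge0 Phi_le).
- by apply: bd_vol_cvg; rewrite mulr_ge0.
- exact: cvg_cst.
Qed.

Lemma logZn_log_Z_free n w : `|logZn n w - log_Z_free (box d n) w / vol n|
  <= C * #|` bd r (box d n)|%:R / vol n.
Proof.
rewrite /logZn mulrC -mulrBl normrM [X in _ * X]ger0_norm ?invr_ge0 // ler_wpM2r ?invr_ge0 //.
exact: (Zpart_Xf Phi_range M_ge0 Phi_le).
Qed.

Lemma logZn_cvg_ae : {ae K, forall w, cvgn (logZn ^~ w)}.
Proof.
have lE0 : 0 <= ln #|E|%:R :> R by rewrite ln_ge0 // ler1n; apply/card_gt0P; exists point.
have : {ae K, forall w, cvgn (fun n => log_Z_free (box d n) w / vol n)}.
  apply: (@Y_cvg_ae _ _ R d r K (@shift d (E * E')%type) _ _ _ log_Z_free C (C + ln #|E|%:R)) => //.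
  - by move=> x y w; exact: shiftD.
  - exact: shift_measurable.
  - by rewrite addr_ge0.
  - by move=> A B w AB; exact: (Xf_union Phi_local Phi_range M_ge0 Phi_le).
  - by move=> A w; exact: (Xf_bound Phi_range M_ge0 Phi_le).
  - by move=> A x w; exact: (Xf_fshift Phi_local Phi_inv).
  - by move=> n; exact: bmeas_log_Z_free.
apply: filterS => w /cvg_ex[l hl]; apply/cvg_ex; exists l.
by apply: cvg_dist hl => [n|]; [exact: logZn_log_Z_free|exact: bd_vol_cvg].
Qed.

Lemma logZn_bound n w : `|logZn n w| <= C + ln #|E|%:R + C.
Proof.
have := logZn_log_Z_free n w; have := Xf_bound Phi_range M_ge0 Phi_le sb (box d n) (disorder w).
rewrite -/(log_Z_free _ _) => h1 h2.
have b1 : `|log_Z_free (box d n) w / vol n| <= C + ln #|E|%:R.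
  by rewrite normrM [X in _ * X]ger0_norm ?invr_ge0 // ler_pdivrMr ?vol_gt0.
have b2 : C * #|` bd r (box d n)|%:R / vol n <= C.
  by rewrite ler_pdivrMr ?vol_gt0 // ler_wpM2l // ler_nat card_bd_le.
rewrite -(subrK (log_Z_free (box d n) w / vol n) (logZn n w)).
apply: le_trans (ler_normD _ _) _; lra.
Qed.

(** Dominated convergence with the uniform bound on [logZn], after which [Zpart] is exchanged for
    [Zf] at surface cost. Finiteness of the integral is recorded for the later addition in the
    extended reals. *)
Lemma Ex_logZn_cvg :
  (\int[K]_w (limn (logZn ^~ w))%:E)%E \is a fin_num /\
  (fun n => Ex (log_Z_free (box d n)) / vol n) @ \oo --> fine (\int[K]_w (limn (logZn ^~ w))%:E)%E.
Proof.
pose B : R := C + ln #|E|%:R + C.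
have mlog n : measurable_fun setT (logZn n) by have [] := bmeas_logZn n.
have mE n : measurable_fun setT (fun w => (logZn n w)%:E) by exact/measurable_EFinP.
have mlim : measurable_fun setT (fun w => (limn (logZn ^~ w))%:E).
  by apply/measurable_EFinP; exact: measurable_limn.
have cae : {ae K, forall w, setT w -> (logZn n w)%:E @[n --> \oo] --> (limn (logZn ^~ w))%:E}.
  apply: filterS logZn_cvg_ae => w hw _.
  by apply: cvg_EFin => //; exact: nearW.
have iB : K.-integrable setT (fun=> B%:E) by exact: (bmeas_integrable K (bmeas_cst B)).
have bnd : {ae K, forall w, forall n, setT w -> (`|(logZn n w)%:E| <= B%:E)%E}.
  by apply: nearW => w n _; rewrite lee_fin; exact: logZn_bound.
have [ilim _ cv] := dominated_convergence measurableT mE mlim cae iB bnd.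
have fin := integrable_fin_num measurableT ilim.
split=> //.
have {}cv : (fun n => Ex (logZn n)) @ \oo --> fine (\int[K]_w (limn (logZn ^~ w))%:E)%E.
  by apply: fine_cvg; rewrite fineK.
apply: (@cvg_dist _ _ _ (fun n => C * #|` bd r (box d n)|%:R / vol n) _ _ _ cv).
  move=> n; have bX := bmeas_log_Z_free (box d n).
  rewrite [X in `|X - _|]mulrC -ExZ //; apply: Ex_dist.
  - exact: bmeasZ.
  - exact: bmeas_logZn.
  - by move=> w; rewrite distrC [X in _ - X]mulrC; exact: logZn_log_Z_free.
exact: bd_vol_cvg.
Qed.

End GibbsFormula.

Theorem theorem6p7 (R : realType) (d : nat) (E E' : FinPointed.type)
  (Phi : {fset site d} -> cfg d (E * E') -> R)
  (P : probability (cfgm d E') R) (sb : cfg d E)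
  (Kb K : probability (cfgm d (E * E')%type) R) :
  (0 < d)%N ->
  pot_local Phi -> pot_finite_range Phi -> pot_trans_inv Phi ->
  asympt_decoupled P ->
  is_joint_measure Phi P sb Kb -> trans_inv_meas Kb ->
  trans_inv_meas K ->
  let logZ := fun (n : nat) (w : cfg d (E * E')) =>
    ((boxcard d n)%:R)^-1 * ln (Zpart Phi (box d n) sb (fun x => (w x).2)) in
  {ae K, forall w, cvgn (logZ ^~ w)} /\
  exists a b c : \bar R,
    relent_seq (marg2 K) P n @[n --> \oo] --> a /\
    ent_seq K n @[n --> \oo] --> b /\
    ent_seq (marg2 K) n @[n --> \oo] --> c /\
    relent_seq K Kb n @[n --> \oo] -->
      (a - b + c
       + (\sum_(A \in [set A : {fset site d} | 0 \in A])
            ((#|` A|%:R)^-1 * fine (\int[K]_w (Phi A w)%:E)))%:E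
       + \int[K]_w (limn (logZ ^~ w))%:E)%E.
Proof.
move=> _ Phi_local [r Phi_range] Phi_inv P_dec Kb_joint _ K_inv logZ.
have [M [M_ge0 Phi_le]] := Phi_bounded Phi_local Phi_range Phi_inv.
split; first exact: (logZn_cvg_ae Phi_local Phi_range Phi_inv M_ge0 Phi_le sb K_inv).
have Kd_inv := disorder_law_inv K_inv.
have [a ha] := relent_cvg Kd_inv P_dec.
have [b hb] := ent_cvg K_inv.
have [c hc] := ent_cvg Kd_inv.
exists a, b%:E, c%:E; do 3!split => //.
have [chi_fin chi_cvg] := Ex_logZn_cvg Phi_local Phi_range Phi_inv M_ge0 Phi_le sb K_inv.
set chi := (\int[K]_w (limn (logZn Phi sb ^~ w))%:E)%E in chi_fin chi_cvg.
have -> : (\int[K]_w (limn (logZ ^~ w))%:E)%E = chi by [].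
rewrite -(Ex_site_energy0 Phi_local Phi_range K) -(fineK chi_fin).
have /choice[t tP] := relent_joint Phi_local Phi_range M_ge0 Phi_le K Kb_joint.
have tcvg : t @ \oo --> (- b + c + (\int[K]_w site_energy0 Phi r w + fine chi) : R).
  have entK : (fun n => entL K (box d n) / (boxcard d n)%:R) @ \oo --> b.
    apply: (@fine_cvg _ _ _ _ (fun n => (entL K (box d n) / (boxcard d n)%:R)%:E)).
    by under eq_fun do rewrite -ent_seqE.
  have entKd : (fun n => entL (disorder_law K) (box d n) / (boxcard d n)%:R) @ \oo --> c.
    apply: (@fine_cvg _ _ _ _ (fun n => (entL (disorder_law K) (box d n) / (boxcard d n)%:R)%:E)).
    by under eq_fun do rewrite -ent_seqE.
  apply: (@cvg_dist _ _ _ _ _ (fun n => (tP n).1)).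
    by apply: bd_vol_cvg; rewrite mulr_ge0 // energy_bound_ge0.
  apply: cvgD; first by apply: cvgD => //; exact: cvgN.
  by apply: cvgD => //; exact: (Ex_energy_in_cvg Phi_local Phi_range Phi_inv M_ge0 Phi_le K_inv).
(* The real terms are grouped because [a] alone may be infinite; addition is then continuous at the
   limit. *)
have -> : (a - b%:E + c%:E + (\int[K]_w site_energy0 Phi r w)%:E + (fine chi)%:E)%E
    = (a + (- b + c + (\int[K]_w site_energy0 Phi r w + fine chi))%:E)%E.
  by rewrite -!addeA -!EFinN -!EFinD !addrA.
have -> : relent_seq K Kb = (fun n => relent_seq (disorder_law K) P n + (t n)%:E)%E.
  by apply/funext => n; exact: (tP n).2.
apply: cvgeD => //; first by rewrite fin_num_adde_defl.
by apply: cvg_EFin => //; exact: nearW.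
Qed.
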